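(* For every $x>0$ and $\mu>0$, the expected value of the time average of $X$ until its first-passage time below zero is $$E\left[\frac{A(x)}{\tau(x)}\right]=\frac{x}{2}\left[1+\int_0^{+\infty}\frac{e^{-sx}}{s+\mu}\,ds\right].$$
   Context: Let $B_t$ be a standard one-dimensional Brownian motion ($B_0=0$). For $x>0$ and $\mu>0$ let $X(t)=x-\mu t+B_t$. The first-passage time below zero is $\tau(x)=\inf\{t>0: X(t)\le 0\}$ (finite almost surely), and the first-passage area is $A(x)=\int_0^{\tau(x)}X(t)\,dt$, so that $A(x)/\tau(x)=\frac{1}{\tau(x)}\int_0^{\tau(x)}X(t)\,dt$ is the time average of $X$ until $\tau(x)$. *)

(* Defs.v *)
From HB Require Import structures.
From mathcomp Require Import all_boot all_order all_algebra.
From mathcomp Require Import all_classical all_reals all_analysis.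
Set Implicit Arguments.
Unset Strict Implicit.
Unset Printing Implicit Defensive.
Import Order.TTheory GRing.Theory Num.Theory.
Import numFieldNormedType.Exports.
Local Open Scope classical_set_scope.
Local Open Scope ring_scope.

(* Product rule over the whole finite family; the rule for a subfamily is the
   case where the remaining sets are [setT]. *)
Definition mutually_independent (R : realType) (d : measure_display)
    (T : measurableType d) (P : probability T R) (n : nat)
    (Y : 'I_n -> T -> R) : Prop :=
  forall A : 'I_n -> set R, (forall i, measurable (A i)) ->
    P (\bigcap_(i : 'I_n) (Y i @^-1` A i)) = (\prod_(i < n) P (Y i @^-1` A i))%E.

(* Time is indexed by [R], but only the times [t >= 0] are constrained.
   The second parameter of [normal_prob] is the standard deviation; it is
   degenerate at [0], whence the strict inequality [s < t]. *)
Record standard_brownian_motion (R : realType) (d : measure_display)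
    (T : measurableType d) (P : probability T R) (B : R -> {RV P >-> R}) : Prop :=
  StandardBrownianMotion {
    bm_start : {ae P, forall w, B 0 w = 0} ;
    bm_indep_increments : forall (n : nat) (t : nat -> R),
      0 <= t 0%N -> nondecreasing_seq t ->
      mutually_independent P (fun i : 'I_n => B (t i.+1) \- B (t i)) ;
    bm_normal_increments : forall s t : R, 0 <= s -> s < t ->
      forall A : set R, measurable A ->
        pushforward P (B t \- B s) A = normal_prob 0 (Num.sqrt (t - s)) A ;
    bm_continuous_paths :
      {ae P, forall w, {within `[0, +oo[, continuous (fun t : R => B t w)}} }.

Section first_passage.
Variables (R : realType) (T : Type) (B : R -> T -> R) (x mu : R).

Definition drifted (t : R) (w : T) : R := x - mu * t + B t w.

(* [inf set0 = 0] for the infimum of the reals; for [0 < mu] and [B] a Brownian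
   motion the set below is almost surely nonempty, so this value of [inf] only
   matters on a null event. *)
Definition first_passage_time (w : T) : R :=
  inf [set t : R | 0 < t /\ drifted t w <= 0].

Definition first_passage_area (w : T) : R :=
  (\int[lebesgue_measure]_(t in `[0, first_passage_time w]) drifted t w)%R.

End first_passage.

(* Main.v *)
(** For [c > 0] let [lambda c = c^2/2 + mu c]. With [a = 1/(2(c + mu))] and
    [b = 1/(2(c + mu)^2)] the process
    [exp (- lambda(c) t - c X_t) (int_0^t X + a X_t^2 + b X_t)] is a martingale, so
    optional stopping gives [E (A exp (- lambda(c) tau)) = exp (- c x) (a x^2 + b x)].
    Since [lambda' (c) = c + mu], one has
    [A / tau = int_0^oo (c + mu) A exp (- lambda(c) tau) dc], and Tonelli reduces the
    expectation to the integral of [(c + mu) exp (- c x) (a x^2 + b x)].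

    No stochastic calculus is needed for the optional stopping: on a time grid of mesh
    [h] the path is a Gaussian random walk, for which a slight change of [b] makes the
    process above an exact discrete martingale. It is stopped at the first grid point
    below a level [e > 0]; the overshoot is controlled by the moment generating function
    of a single increment. A second-moment bound uniform in [h] lets the expectations
    converge as [h] tends to [0], the stopping time then being the first time
    strictly below [e], and again as [e] tends to [0]. *)

Require Import Defs.
From HB Require Import structures.
From mathcomp Require Import all_boot all_order all_algebra.
From mathcomp Require Import all_classical all_reals all_analysis.
From mathcomp Require Import measurable_realfun simple_functions.
From mathcomp Require Import ring lra.
Set Implicit Arguments.
Unset Strict Implicit.
Unset Printing Implicit Defensive.
Import Order.TTheory GRing.Theory Num.Theory.
Import numFieldNormedType.Exports.
Local Open Scope classical_set_scope.
Local Open Scope ring_scope.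

(** * Integrals and expectations *)

(** The pathwise limits dictate how the walk is stopped. Being strictly below a positive level is an
    open condition, which every fine enough grid detects. The passage time itself comes from a
    closed condition; it is the limit of the level-crossing times as the level decreases, on any
    continuous path that starts positive and becomes negative.

    The overshoot is estimated by summing over all grid steps. A fourth moment of an increment is of
    order h^2, so with horizon N, mesh N^-5 (hence N^6 steps) and tolerance 1/N for the overshoot
    the total is N^6 N^-10 N^3 = 1/N.

    The constants a and b come from the generator: u(y) = a y^2 + b y solves u''/2 - (c + mu) u' + y
    = 0, the y being the growth rate of the area.

    The other obstacle is measurability. The passage time and the area are not given as measurable
    functions, and the paths are regular only off a null set. Integrals are therefore compared off
    null sets without measurability; the area is recovered as a limit of damped areas, and the time
    from a logarithm of their ratio. *)

Section off_null_set.
Context d (T : measurableType d) (R : realType).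
Variable mu : {measure set T -> \bar R}.
Import HBNNSimple.

(** Simple functions are measurable, so setting one to zero on [N] falls under [ae_eq_integral]. *)
Lemma sintegral_restr_off_null (N : set T) (h : {nnsfun T >-> R})
    (mN : measurable N) : mu N = 0%E ->
  sintegral mu h = sintegral mu (proj_nnsfun h (measurableC mN)).
Proof.
move=> N0; rewrite -!integralT_nnsfun.
apply: ae_eq_integral => //.
- exact/measurable_EFinP.
- exact/measurable_EFinP.
- exists N; split=> // x /= hx; apply: contrapT => nNx; apply: hx => _.
  by rewrite mindicE mem_set//= mulr1.
Qed.

(** The integral of a nonnegative function is a supremum over the simple functions below it,
    measurable or not. A simple function below [f], set to zero on [N], lies below [g] and keeps its
    integral. *)
Let le_sup_off_null (N : set T) (f g : T -> \bar R) :
  measurable N -> mu N = 0%E -> (forall x, 0 <= g x)%E ->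
  (forall x, ~ N x -> f x = g x) ->
  (ereal_sup [set sintegral mu h | h in
     [set h : {nnsfun T >-> R} | forall x, ((h x)%:E <= f x)%E]] <=
   ereal_sup [set sintegral mu h | h in
     [set h : {nnsfun T >-> R} | forall x, ((h x)%:E <= g x)%E]])%E.
Proof.
move=> mN N0 g0 fg; apply: ge_ereal_sup => _ [h /= hf <-].
apply: ereal_sup_ubound; exists (proj_nnsfun h (measurableC mN)); last first.
  by rewrite -sintegral_restr_off_null.
move=> x /=; rewrite mindicE; have [/set_mem Nx|/negP nNx] := boolP (x \in ~` N).
  by rewrite mulr1 -fg.
by rewrite mulr0.
Qed.

(* No measurability of [f] or [g] is required, unlike in [ae_eq_integral]. *)
Lemma eq_integral_off_null (N : set T) (f g : T -> \bar R) :
  measurable N -> mu N = 0%E -> (forall x, ~ N x -> f x = g x) ->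
  (\int[mu]_x f x = \int[mu]_x g x)%E.
Proof.
move=> mN N0 fg; rewrite /integral !patch_setT; congr (_ - _)%E.
  apply/eqP; rewrite eq_le; apply/andP; split;
    apply: (le_sup_off_null mN N0) => // x Nx; by rewrite !funeposE fg.
apply/eqP; rewrite eq_le; apply/andP; split;
  apply: (le_sup_off_null mN N0) => // x Nx; by rewrite !funenegE fg.
Qed.

End off_null_set.

Section expectation.
Context d (T : measurableType d) (R : realType).
Variable P : probability T R.
Local Notation Ex f := (\int[P]_x f x)%R.
Local Notation integ f := (P.-integrable setT (EFin \o f)).

Lemma integ_measurable (f : T -> R) : integ f -> measurable_fun setT f.
Proof. by move=> /integrableP[/measurable_EFinP]. Qed.

Lemma integ_cst (r : R) : integ (cst r).
Proof. exact: finite_measure_integrable_cst. Qed.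

Lemma Ex_cst (r : R) : Ex (fun=> r) = r.
Proof. by rewrite Rintegral_cst//= probability_setT mulr1. Qed.

Lemma integ_le (f g : T -> R) : measurable_fun setT f -> integ g ->
  (forall x, `|f x| <= g x) -> integ f.
Proof.
move=> mf ig fg; apply: le_integrable ig => //; first exact/measurable_EFinP.
by move=> x _ /=; rewrite lee_fin (le_trans (fg x)) ?ler_norm.
Qed.

Lemma integD (f g : T -> R) : integ f -> integ g -> integ (fun x => f x + g x).
Proof. by move=> ? ?; rewrite (_ : EFin \o _ = (EFin \o f) \+ (EFin \o g))%E//; exact: integrableD. Qed.

Lemma integZ (r : R) (f : T -> R) : integ f -> integ (fun x => r * f x).
Proof. by move=> ?; rewrite (_ : EFin \o _ = (fun x => r%:E * (EFin \o f) x))%E//; exact: integrableZl. Qed.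

Lemma ExD (f g : T -> R) : integ f -> integ g ->
  Ex (fun x => f x + g x) = Ex f + Ex g.
Proof. by move=> ? ?; rewrite RintegralD. Qed.

Lemma ExZ (r : R) (f : T -> R) : integ f -> Ex (fun x => r * f x) = r * Ex f.
Proof. by move=> ?; rewrite RintegralZl. Qed.

Lemma Ex_le (f g : T -> R) : integ f -> integ g -> (forall x, f x <= g x) ->
  Ex f <= Ex g.
Proof. by move=> ? ? fg; apply: le_Rintegral. Qed.

Lemma integ_sum (n : nat) (f : nat -> T -> R) : (forall i, (i < n)%N -> integ (f i)) ->
  integ (fun x => \sum_(i < n) f i x).
Proof.
move=> fi; rewrite (_ : EFin \o _ = (fun x => \sum_(i < n) (f i x)%:E))%E; last first.
  by apply/funext => x /=; rewrite sumEFin.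
by apply: integrable_sum => // i _; apply: fi.
Qed.

Lemma Ex_sum (n : nat) (f : nat -> T -> R) : (forall i, (i < n)%N -> integ (f i)) ->
  Ex (fun x => \sum_(i < n) f i x) = \sum_(i < n) Ex (f i).
Proof.
elim: n => [|n IH] fi.
  by rewrite big_ord0; under eq_Rintegral do rewrite big_ord0; rewrite Ex_cst.
under eq_Rintegral do rewrite big_ord_recr/=.
rewrite ExD ?IH ?big_ord_recr//=.
- by move=> i ni; apply: fi; exact: ltnW.
- by apply: integ_sum => i ni; apply: fi; exact: ltnW.
- exact: fi.
Qed.

Lemma EFin_Ex (f : T -> R) : integ f -> ((Ex f)%:E = \int[P]_x (f x)%:E)%E.
Proof. by move=> fi; rewrite /Rintegral fineK//; exact: integrable_fin_num. Qed.

Lemma integ_ge0_bound (f : T -> R) (C : R) : measurable_fun setT f ->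
  (forall x, 0 <= f x) -> (\int[P]_x (f x)%:E <= C%:E)%E -> integ f.
Proof.
move=> mf f0 fC; apply/integrableP; split; first exact/measurable_EFinP.
under eq_integral do rewrite /= ger0_norm//.
by rewrite (le_lt_trans fC) ?ltry.
Qed.

Lemma integ_L2 (f : T -> R) : measurable_fun setT f -> integ (fun x => f x ^+ 2) ->
  integ f.
Proof.
move=> mf f2; apply: (@integ_le _ (fun x => 1 + f x ^+ 2)) => //.
  by apply: integD => //; exact: integ_cst.
move=> x; rewrite -(real_normK (num_real (f x))).
by have := normr_ge0 (f x); nra.
Qed.

Lemma integ_L2D (f g : T -> R) : measurable_fun setT f -> measurable_fun setT g ->
  integ (fun x => f x ^+ 2) -> integ (fun x => g x ^+ 2) ->
  integ (fun x => (f x + g x) ^+ 2).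
Proof.
move=> mf mg f2 g2; apply: (@integ_le _ (fun x => 2 * f x ^+ 2 + 2 * g x ^+ 2)).
- by apply: measurable_funX; exact: measurable_funD.
- by apply: integD; exact: integZ.
- move=> x; rewrite ger0_norm ?sqr_ge0// -subr_ge0.
  rewrite (_ : _ - _ = (f x - g x) ^+ 2) ?sqr_ge0//; ring.
Qed.

(* The second-moment bound gives uniform integrability, so no dominating function is needed. *)
Lemma cvg_Ex_L2_bounded (f : nat -> T -> R) (g : T -> R) (C : R) :
  (forall n, measurable_fun setT (f n)) -> (forall n x, 0 <= f n x) ->
  (forall n, integ (fun x => f n x ^+ 2)) ->
  (forall n, Ex (fun x => f n x ^+ 2) <= C) ->
  (forall x, f n x @[n --> \oo] --> g x) ->
  [/\ measurable_fun setT g, integ (fun x => g x ^+ 2),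
      Ex (fun x => g x ^+ 2) <= C & Ex (f n) @[n --> \oo] --> Ex g].
Proof.
move=> mf f0 if2 fC fg.
have mg : measurable_fun setT g by apply: (measurable_fun_cvg mf) => x _; exact: fg.
have g0 x : 0 <= g x.
  have := fg x => /(@cvg_lim _ _) <-//; apply: limr_ge; first by apply/cvg_ex; exists (g x).
  by near=> n; exact: f0.
(* Fatou's lemma carries the second-moment bound over to the limit. *)
have g2C : (\int[P]_x (g x ^+ 2)%:E <= C%:E)%E.
  have cv2 x : (f n x ^+ 2)%:E @[n --> \oo] --> (g x ^+ 2)%:E.
    apply: cvg_EFin; first exact: nearW.
    by under eq_fun do rewrite /= expr2; rewrite expr2; exact: cvgM.
  have lim2 x : limn_einf (fun n => (f n x ^+ 2)%:E) = (g x ^+ 2)%:E.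
    by rewrite is_cvg_limn_einfE; [exact/cvg_lim|apply/cvg_ex; exists (g x ^+ 2)%:E].
  under eq_integral do rewrite -lim2.
  apply: le_trans (fatou _ _ _ _) _ => //.
  - by move=> n; apply/measurable_EFinP; exact: measurable_funX.
  - by move=> n x _; rewrite lee_fin sqr_ge0.
  - rewrite limn_einf_lim; apply: lime_le; first exact: is_cvg_einfs.
    near=> n; apply: (@le_trans _ _ (\int[P]_x (f n x ^+ 2)%:E)%E).
      by apply: ereal_inf_lbound; exists n => /=.
    by rewrite -EFin_Ex// lee_fin.
have ig2 : integ (fun x => g x ^+ 2).
  by apply: integ_ge0_bound g2C => //; [exact: measurable_funX|move=> x; exact: sqr_ge0].
split=> //; first by rewrite -lee_fin EFin_Ex.
have ifn n : integ (f n) by exact: integ_L2.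
have ig : integ g by exact: integ_L2.
have C0 : 0 <= C by rewrite (le_trans _ (fC 0%N))// Rintegral_ge0// => x _; rewrite sqr_ge0.
have mmin M (u : T -> R) : measurable_fun setT u -> measurable_fun setT (fun x => Num.min (u x) M).
  by move=> mu; exact: measurable_minr.
have imin M (u : T -> R) : 0 < M -> (forall x, 0 <= u x) -> integ u -> integ (fun x => Num.min (u x) M).
  move=> M0 u0 iu; apply: (integ_le _ iu); first by apply/mmin/integ_measurable.
  by move=> x; rewrite ger0_norm ?ge_min ?lexx// le_min u0 ltW.
(* Pointwise [u <= min(u, M) + u^2 / M], so truncation at [M] costs at most [C / M], uniformly along
   the sequence; the truncated functions converge by domination. *)
have trunc M (u : T -> R) : 0 < M -> (forall x, 0 <= u x) -> integ u ->
    integ (fun x => u x ^+ 2) -> Ex (fun x => u x ^+ 2) <= C ->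
    `|Ex u - Ex (fun x => Num.min (u x) M)| <= C / M.
  move=> M0 u0 iu iu2 uC.
  have ? := imin _ _ M0 u0 iu.
  rewrite ger0_norm; last by rewrite subr_ge0; apply: Ex_le => // x; rewrite ge_min lexx.
  rewrite lerBlDr (le_trans (_ : _ <= Ex (fun x => M^-1 * u x ^+ 2 + Num.min (u x) M)))//.
    apply: Ex_le => //; first by apply: integD => //; exact: integZ.
    move=> x; rewrite minEle; case: ifPn => uM; first by rewrite lerDr mulr_ge0 ?sqr_ge0// invr_ge0 ltW.
    move: uM; rewrite -ltNge => uM; rewrite -lerBlDr.
    rewrite -(ler_pM2l M0) mulrA divff ?gt_eqF// mul1r.
    by nra.
  rewrite ExD//; last exact: integZ.
  by rewrite ExZ// lerD2r mulrC ler_pM2r// invr_gt0.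
have cmin M : 0 < M -> Ex (fun x => Num.min (f n x) M) @[n --> \oo] --> Ex (fun x => Num.min (g x) M).
  move=> M0; apply: fine_cvg; rewrite fineK; last by apply: integrable_fin_num => //; exact: imin.
  apply: (@dominated_cvg _ _ _ P setT measurableT (fun n x => (Num.min (f n x) M)%:E) _ (cst M%:E)) => //=.
  - by move=> n; apply/measurable_EFinP; exact: mmin.
  - move=> x _; apply: cvg_EFin; first exact: nearW.
    apply/cvgrPdist_le => e e0; near=> n => /=.
    have : `|g x - f n x| <= e by near: n; have /cvgrPdist_le := fg x; apply.
    rewrite !minEle; do 2 (case: ifPn; rewrite -?ltNge => ?);
      move=> /ler_normlP[? ?]; apply/ler_normlP; split; lra.
  - exact: integ_cst.
  - move=> n x _; rewrite lee_fin ger0_norm ?ge_min ?lexx ?orbT//.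
    by rewrite le_min f0 ltW.
apply/cvgrPdist_le => e e0.
(* [C + 1] instead of [C] keeps [M] positive when [C = 0]. *)
pose M := (C + 1) / (e / 3).
have M0 : 0 < M by rewrite /M !divr_gt0//; lra.
have CM : C / M <= e / 3.
  rewrite ler_pdivrMr// /M mulrC divfK; first by lra.
  by rewrite gt_eqF//; lra.
near=> n.
have h1 := trunc M g M0 g0 ig ig2 _; have := h1 => /(_ _) {}h1.
have {}h1 : `|Ex g - Ex (fun x => Num.min (g x) M)| <= C / M.
  by apply: h1; rewrite -lee_fin EFin_Ex.
have h2 := trunc M (f n) M0 (f0 n) (ifn n) (if2 n) (fC n).
have h3 : `|Ex (fun x => Num.min (g x) M) - Ex (fun x => Num.min (f n x) M)| <= e / 3.
  near: n; have := cmin M M0 => /cvgrPdist_le; apply; lra.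
move: h1 h2 h3 => /ler_normlP[h1 h1'] /ler_normlP[h2 h2'] /ler_normlP[h3 h3'].
by apply/ler_normlP; split; lra.
Unshelve. all: by end_near. Qed.

End expectation.

(** * Independence from a generated sigma-algebra *)

Section independence.
Context d (T : measurableType d) (R : realType).
Variable P : probability T R.
Local Notation Ex f := (\int[P]_x f x)%R.
Local Notation integ f := (P.-integrable setT (EFin \o f)).
Variables (G : set (set T)) (Z : T -> R).
Hypothesis mZ : measurable_fun setT Z.
Hypothesis Gm : G `<=` measurable.
Hypothesis GI : setI_closed G.
Hypothesis GT : G setT.
Hypothesis GZ : forall A D, G A -> measurable D ->
  P (A `&` Z @^-1` D) = (P A * P (Z @^-1` D))%E.

(** For fixed [D] both sides are finite measures in [A] that agree on the pi-system [G], hence on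
    the sigma-algebra it generates. *)
Lemma indep_sigma A D : <<s G >> A -> measurable D ->
  P (A `&` Z @^-1` D) = (P A * P (Z @^-1` D))%E.
Proof.
move=> sA mD.
have mZD : measurable (Z @^-1` D) by rewrite -[X in measurable X]setTI; exact: mZ.
have fp := fin_num_measure P _ mZD.
have c0 : 0 <= fine (P (Z @^-1` D)) by exact: fine_ge0.
have := @g_sigma_algebra_measure_unique _ _ T G Gm (fun=> setT) (fun=> GT) _
  (mrestr P mZD) (mscale (NngNum c0) P) GI _ _ A sA.
move=> h; transitivity (mrestr P mZD A); first by [].
rewrite h.
- by change ((fine (P (Z @^-1` D)))%:E * P A = P A * P (Z @^-1` D))%E; rewrite fineK// muleC.
- by apply/seteqP; split=> x //= _; exists 0%N.
- move=> B GB; change (P (B `&` Z @^-1` D) = (fine (P (Z @^-1` D)))%:E * P B)%E.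
  by rewrite GZ// fineK// muleC.
- by move=> _; change (P (setT `&` Z @^-1` D) < +oo)%E; rewrite setTI ltey_eq fp.
Qed.

Variables (U : T -> R) (g : R -> R).
Hypothesis mU : @measurable_fun _ _ (g_sigma_algebraType G) R setT U.
Hypothesis mg : measurable_fun setT g.
Hypothesis iU : integ U.
Hypothesis ig : integ (g \o Z).

Let mU' : measurable_fun setT U.
Proof. exact: integ_measurable iU. Qed.

Let Urv : {RV P >-> R} := mfun_Sub (mem_set mU').
Let Zrv : {RV P >-> R} := mfun_Sub (mem_set mZ).
Let UZ (w : T) := (U w, Z w).
Let mUZ : measurable_fun setT UZ.
Proof. exact: measurable_fun_pair. Qed.

Let joint (X : set (R * R)) : measurable X ->
  ((distribution P Urv) \x (distribution P Zrv))%E X = pushforward P UZ X.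
Proof.
move=> mX; apply: product_measure_unique => // A D mA mD.
rewrite /distribution /pushforward/=.
transitivity (P ((U @^-1` A) `&` (Z @^-1` D))); first by [].
apply: indep_sigma => //.
by have := mU measurableT mA; rewrite setTI.
Qed.

Let f (x : R * R) : \bar R := (x.1 * g x.2)%:E.
Let mf : measurable_fun setT f.
Proof.
apply/measurable_EFinP; apply: measurable_funM => //.
by apply: measurableT_comp => //; exact: measurable_snd.
Qed.

Let push_law (h : R -> R) (V : T -> R) (mV : measurable_fun setT V) : measurable_fun setT h ->
  integ (h \o V) -> (\int[distribution P (mfun_Sub (mem_set mV) : {RV P >-> R})]_x (h x)%:E = (Ex (h \o V))%:E)%E.
Proof.
move=> mh ih; rewrite EFin_Ex// /distribution integral_pushforward//.
by apply/measurable_EFinP.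
Qed.

Let intf : ((distribution P Urv) \x (distribution P Zrv))%E.-integrable setT f.
Proof.
apply/integrable12ltyP => //.
under eq_integral => u _.
  under eq_integral => z _ do rewrite /f/= normrM EFinM.
  rewrite ge0_integralZl//; last first.
    by apply/measurable_EFinP; exact: measurableT_comp.
  rewrite (push_law (h := fun z => `|g z|) mZ); first last.
  - by apply: integrable_norm.
  - exact: measurableT_comp.
  over.
rewrite ge0_integralZr//; first last.
- by rewrite lee_fin; apply: Rintegral_ge0 => w _; exact: normr_ge0.
- by apply/measurable_EFinP; exact: normr_measurable.
rewrite (push_law (h := fun z => `|z|) mU')//; last by apply: integrable_norm.
by rewrite -EFinM ltry.
Qed.

(** By [joint] the law of the pair [(U, Z)] is the product of the two laws, since it factors on
    rectangles; integrability comes from Tonelli and the product formula from Fubini under that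
    law. *)
Lemma indep_prod : integ (fun w => U w * g (Z w)) /\
  Ex (fun w => U w * g (Z w)) = Ex U * Ex (g \o Z).
Proof.
have i1 : (pushforward P UZ).-integrable setT f.
  have /integrableP[_] := intf => lt.
  apply/integrableP; split=> //.
  rewrite (eq_measure_integral ((distribution P Urv) \x (distribution P Zrv))%E)//.
  by move=> A mA _; exact/esym/joint.
have i2 : integ (fun w => U w * g (Z w)).
  move/integrableP : i1 => [_]; rewrite ge0_integral_pushforward//; last first.
    exact: measurableT_comp.
  move=> h; apply/integrableP; split => //.
  by apply/measurable_EFinP; apply: measurable_funM => //; exact: measurableT_comp.
split=> //; apply: EFin_inj; rewrite EFin_Ex//.
transitivity (\int[pushforward P UZ]_x f x)%E; first by rewrite integral_pushforward.
rewrite (eq_measure_integral ((distribution P Urv) \x (distribution P Zrv))%E); last first.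
  by move=> A mA _; exact/esym/joint.
rewrite -integral12_prod_meas1// /fubini_F.
under eq_integral => u _.
  under eq_integral => z _ do rewrite /f/= EFinM.
  rewrite integralZl//; last first.
    by apply: integrable_pushforward => //; exact/measurable_EFinP.
  rewrite (push_law mZ)//.
  over.
rewrite integralZr//; last first.
  by apply: (@integrable_pushforward _ _ _ _ _ _ mU' P setT EFin).
by rewrite (push_law (h := id) mU')// EFinM.
Qed.

End independence.

(** * Gaussian moments *)

Section normal_mgf.
Context (R : realType).
Local Notation mu := (@lebesgue_measure R).

(** The Radon-Nikodym derivative of [normal_prob] and [normal_pdf] have the same integral over every
    measurable set, hence agree almost everywhere. *)
Lemma ge0_integral_normal_prob (m s : R) (f : R -> R) :
  measurable_fun setT f -> (forall x, 0 <= f x) ->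
  (\int[normal_prob m s]_x (f x)%:E = \int[mu]_x (f x * normal_pdf m s x)%:E)%E.
Proof.
move=> mf f0.
have dom := normal_prob_dominates m s.
rewrite -(Radon_Nikodym_SigmaFinite.change_of_variables dom)//; last first.
  exact/measurable_EFinP.
apply: ae_eq_integral => //.
- apply: emeasurable_funM; first exact/measurable_EFinP.
  exact: measurable_int (Radon_Nikodym_SigmaFinite.f_integrable dom).
- by apply/measurable_EFinP; apply: measurable_funM => //; exact: measurable_normal_pdf.
- have := @integral_ae_eq _ _ _ mu setT measurableT
    (fun x => (normal_pdf m s x)%:E) _ (Radon_Nikodym_SigmaFinite.f_integrable dom).
  have mpdf : measurable_fun setT (fun x => (normal_pdf m s x)%:E).
    by apply/measurable_EFinP; exact: measurable_normal_pdf.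
  move=> /(_ mpdf) h; have {h} := h _; move=> h.
  have ha : ae_eq mu setT (Radon_Nikodym_SigmaFinite.f (normal_prob m s) mu) (fun x => (normal_pdf m s x)%:E).
    by apply: h => E _ mE; rewrite -(Radon_Nikodym_SigmaFinite.f_integral dom).
  by apply: filterS ha => x /= hx _; rewrite hx// EFinM.
Qed.

(** Completing the square; the shifted density still integrates to 1, which leaves the moment
    generating function. *)
Lemma normal_pdf_tilt (s t x : R) : s != 0 ->
  expR (t * x) * normal_pdf 0 s x =
  expR (t ^+ 2 * s ^+ 2 / 2) * normal_pdf (t * s ^+ 2) s x.
Proof.
move=> s0; rewrite !normal_pdfE// /normal_fun mulrCA [RHS]mulrCA; congr (_ * _).
by rewrite -!expRD; congr expR; field.
Qed.

Lemma normal_prob_mgf (s t : R) : s != 0 ->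
  (\int[normal_prob 0 s]_x (expR (t * x))%:E = (expR (t ^+ 2 * s ^+ 2 / 2))%:E)%E.
Proof.
move=> s0; rewrite ge0_integral_normal_prob//; last first.
  by apply: measurableT_comp => //; exact: measurable_funM.
under eq_integral do rewrite normal_pdf_tilt// EFinM.
rewrite ge0_integralZl ?lee_fin ?expR_ge0//.
- by rewrite integral_normal_pdf mule1.
- by apply/measurable_EFinP; exact: measurable_normal_pdf.
- by move=> x _; rewrite lee_fin normal_pdf_ge0.
Qed.

End normal_mgf.

Section moments.
Context d (T : measurableType d) (R : realType).
Variable P : probability T R.
Local Notation Ex f := (\int[P]_x f x)%R.
Local Notation integ f := (P.-integrable setT (EFin \o f)).

Lemma normal_rv_mgf (Z : T -> R) (v t : R) : measurable_fun setT Z -> 0 < v ->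
  (forall A, measurable A -> pushforward P Z A = normal_prob 0 (Num.sqrt v) A) ->
  integ (fun w => expR (t * Z w)) /\
  Ex (fun w => expR (t * Z w)) = expR (t ^+ 2 * v / 2).
Proof.
move=> mZ v0 lawZ.
have me : measurable_fun setT (fun x : R => expR (t * x)).
  by apply: measurableT_comp => //; exact: measurable_funM.
have meZ : measurable_fun setT (fun w => expR (t * Z w)).
  by apply: (measurableT_comp me).
have E1 : (\int[P]_w (expR (t * Z w))%:E = (expR (t ^+ 2 * v / 2))%:E)%E.
  (* [normal_prob] lives on [measurableTypeR R], whose display differs from that of [R]. *)
  have mZ' : @measurable_fun _ _ T (measurableTypeR R) setT Z by exact: mZ.
  transitivity (\int[@pushforward _ _ T (measurableTypeR R) R P Z]_x (expR (t * x))%:E)%E.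
    rewrite (ge0_integral_pushforward mZ')//; exact/measurable_EFinP.
  transitivity (\int[normal_prob 0 (Num.sqrt v)]_x (expR (t * x))%:E)%E.
    by apply: (eq_measure_integral (normal_prob 0 (Num.sqrt v))) => A mA _; exact: lawZ.
  by rewrite normal_prob_mgf ?sqr_sqrtr ?ltW// gt_eqF// sqrtr_gt0.
have i1 : integ (fun w => expR (t * Z w)).
  by apply: (@integ_ge0_bound _ _ _ _ _ (expR (t ^+ 2 * v / 2))) => //;
    rewrite ?E1.
by split=> //; apply: EFin_inj; rewrite EFin_Ex.
Qed.

Lemma le_fact_expR (n : nat) (x : R) : `|x| ^+ n <= n`!%:R * expR `|x|.
Proof.
case: n => [|n]; first by rewrite expr0 fact0 mul1r -expR0 ler_expR.
have h := @expR_ge1Dxn R `|x| n (normr_ge0 _).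
have f0 : 0 < n.+1`!%:R :> R by rewrite ltr0n fact_gt0.
by rewrite mulrC -ler_pdivrMr// (le_trans _ h)// lerDr.
Qed.

Lemma expR_abs_le (x : R) : expR `|x| <= expR x + expR (- x).
Proof.
by case: (lerP 0 x) => x0; [rewrite ger0_norm|rewrite ltr0_norm]; rewrite ?lerDl ?lerDr ?expR_ge0.
Qed.

Variables (Z : T -> R) (v : R).
Hypothesis mZ : measurable_fun setT Z.
Hypothesis v0 : 0 < v.
Hypothesis lawZ : forall A, measurable A -> pushforward P Z A = normal_prob 0 (Num.sqrt v) A.

Let mexp (t : R) : measurable_fun setT (fun w => expR (t * Z w)).
Proof. by apply: measurableT_comp => //; exact: measurable_funM. Qed.

Lemma normal_integ_polyexp (k : nat) (t : R) :
  integ (fun w => Z w ^+ k * expR (t * Z w)).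
Proof.
(* The extra unit in the exponent absorbs the power of [Z], by [le_fact_expR]. *)
pose b := `|t| + 1.
apply: (@integ_le _ _ _ _ _ (fun w => k`!%:R * (expR (b * Z w) + expR (- b * Z w)))).
- by apply: measurable_funM => //; exact: measurable_funX.
- by apply: integZ; apply: integD; apply: (normal_rv_mgf _ mZ v0 lawZ).1.
move=> w; rewrite normrM normrX (ger0_norm (expR_ge0 _)).
have bE : `|b * Z w| = `|t| * `|Z w| + `|Z w|.
  by rewrite normrM {1}/b ger0_norm ?addr_ge0// mulrDl mul1r.
have := expR_abs_le (b * Z w); rewrite bE mulNr => h.
rewrite (le_trans _ (ler_wpM2l _ h)) ?ler0n// addrC expRD mulrA.
rewrite ler_pM ?exprn_ge0 ?expR_ge0 ?le_fact_expR// ler_expR -normrM.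
exact: ler_norm.
Qed.

(** Differentiation in [t] under the expectation brings down one more factor [Z], so the tilted
    moments follow one after the other from the moment generating function. *)
Let Ex_next (k : nat) (t : R) (F : R -> R) (f' : R) :
  (forall t, Ex (fun w => Z w ^+ k * expR (t * Z w)) = F t) -> is_derive t 1 F f' ->
  Ex (fun w => Z w ^+ k.+1 * expR (t * Z w)) = f'.
Proof.
move=> EF dF.
have -> : f' = F^`()%classic t by rewrite derive1E derive_val.
have dp (s : R) w : is_derive s 1 (fun s => Z w ^+ k * expR (s * Z w)) (Z w ^+ k.+1 * expR (s * Z w)).
  by apply: is_derive_eq; rewrite !scaler0 /GRing.scale/= exprS; ring.
(* One unit for the power of [Z], one for letting [s] range over the interval of radius 1 around
   [t]. *)
pose b := `|t| + 2.
have := @differentiation_under_integral R d T P (fun s w => Z w ^+ k * expR (s * Z w)) setT measurableT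
   t (t - 1) (t + 1) _ _ _ (fun w => k.+1`!%:R * (expR (b * Z w) + expR (- b * Z w))) _ _ _.
have -> : (fun x' => \int[P]_y (Z y ^+ k * expR (x' * Z y))) = F by apply/funext.
move=> ->.
- by apply: eq_Rintegral => w _; rewrite /partial1of2 derive1E derive_val.
- by rewrite /= in_itv/=; apply/andP; split; lra.
- by move=> s _; exact: normal_integ_polyexp.
- by move=> s w _ _; exact: ex_derive.
- by move=> w; rewrite mulr_ge0// addr_ge0// expR_ge0.
- by apply: integZ; apply: integD; apply: (normal_rv_mgf _ mZ v0 lawZ).1.
move=> s w; rewrite /= in_itv/= => /andP[ts st] _.
rewrite /partial1of2 derive1E derive_val normrM normrX (ger0_norm (expR_ge0 _)).
have bE : `|b * Z w| = (`|t| + 1) * `|Z w| + `|Z w|.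
  by rewrite normrM {1}/b ger0_norm ?addr_ge0//; ring.
have := expR_abs_le (b * Z w); rewrite bE mulNr => h.
rewrite (le_trans _ (ler_wpM2l _ h)) ?ler0n// addrC expRD mulrA.
rewrite ler_pM ?exprn_ge0 ?expR_ge0 ?le_fact_expR// ler_expR.
rewrite (le_trans (ler_norm _))// normrM ler_wpM2r//.
have := ler_norm t; have := ler_norm (- t); rewrite normrN => ? ?.
by apply/ler_normlP; split; lra.
Qed.

Lemma normal_Ex_exp (t : R) : Ex (fun w => expR (t * Z w)) = expR (t ^+ 2 * v / 2).
Proof. exact: (normal_rv_mgf t mZ v0 lawZ).2. Qed.

Lemma normal_Ex_Zexp (t : R) :
  Ex (fun w => Z w * expR (t * Z w)) = t * v * expR (t ^+ 2 * v / 2).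
Proof.
apply: (@Ex_next 0%N t (fun t => expR (t ^+ 2 * v / 2))).
- by move=> s; under eq_Rintegral do rewrite expr0 mul1r; exact: normal_Ex_exp.
- by apply: is_derive_eq; rewrite !scaler0 /GRing.scale/=; field.
Qed.

Lemma normal_Ex_Z2exp (t : R) :
  Ex (fun w => Z w ^+ 2 * expR (t * Z w)) = (v + t ^+ 2 * v ^+ 2) * expR (t ^+ 2 * v / 2).
Proof.
apply: (@Ex_next 1%N t (fun t => t * v * expR (t ^+ 2 * v / 2))) => //.
- by move=> s; exact: normal_Ex_Zexp.
- by apply: is_derive_eq; rewrite !scaler0 /GRing.scale/=; field.
Qed.

End moments.

(** * The stopped area of a discrete path *)

Section discrete_path.
Context (R : realType).
Implicit Types (s : nat -> R) (h lam : R).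

(** A left Riemann sum: at a first crossing at index [k.+1] it involves only [s 0] to [s k], which
    are all nonnegative. *)
Definition area h s k : R := h * \sum_(j < k) s j.
(** A real-valued indicator, so that it can be multiplied into expectations. The value [s 0] is not
    tested. *)
Definition alive s k : R := \prod_(i < k) (0 <= s i.+1)%R%:R.
Definition crossing s k : R := alive s k * (s k.+1 < 0)%R%:R.
(** At most one term is nonzero: the result is the discounted area at the first negative index, or 0
    if there is none up to [K]. *)
Definition disc lam h K s : R :=
  \sum_(k < K) crossing s k * (expR (- (lam * (k.+1%:R * h))) * area h s k.+1).
(* A pathwise majorant of [disc] whose second moment is bounded uniformly in [h] and [K]. *)
Definition dom lam h K s : R := h * \sum_(j < K) expR (- (lam * (j%:R * h))) * `|s j|.

Lemma alive0 s : alive s 0 = 1. Proof. by rewrite /alive big_ord0. Qed.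

Lemma aliveS s k : alive s k.+1 = alive s k * (0 <= s k.+1)%R%:R.
Proof. by rewrite /alive big_ord_recr. Qed.

Lemma alive01 s k : 0 <= alive s k <= 1.
Proof.
elim: k => [|k /andP[h0 h1]]; first by rewrite alive0 ler01 lexx.
by rewrite aliveS; case: (0 <= s k.+1); rewrite ?mulr1 ?mulr0 ?h0 ?h1 ?lexx ?ler01.
Qed.

Lemma alive_ge0 s k : 0 <= alive s k. Proof. by have /andP[] := alive01 s k. Qed.

Lemma alive_bool s k : alive s k = 0 \/
  (alive s k = 1 /\ forall i, (i < k)%N -> 0 <= s i.+1).
Proof.
elim: k => [|k [IH|[IH1 IH2]]]; first by right; rewrite alive0; split.
  by left; rewrite aliveS IH mul0r.
rewrite aliveS IH1 mul1r; case: (lerP 0 (s k.+1)) => hk; last by left.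
by right; split=> // i; rewrite ltnS leq_eqVlt => /predU1P[->//|/IH2].
Qed.

Lemma crossingE s k : crossing s k = alive s k - alive s k.+1.
Proof.
rewrite /crossing aliveS ltNge; case: (0 <= s k.+1); rewrite /= ?mulr1 ?mulr0; ring.
Qed.

Lemma crossing_ge0 s k : 0 <= crossing s k.
Proof. by rewrite mulr_ge0 ?alive_ge0 ?ler0n. Qed.

Lemma sum_crossing s K : \sum_(k < K) crossing s k = 1 - alive s K.
Proof.
elim: K => [|K IH]; first by rewrite big_ord0 alive0 subrr.
by rewrite big_ord_recr/= IH crossingE; ring.
Qed.

Lemma sum_crossing_le1 s K : \sum_(k < K) crossing s k <= 1.
Proof. by rewrite sum_crossing gerBl alive_ge0. Qed.

Lemma crossing_bool s k : 0 <= s 0%N -> crossing s k = 0 \/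
  [/\ crossing s k = 1, s k.+1 < 0 & forall i, (i <= k)%N -> 0 <= s i].
Proof.
move=> s0; rewrite /crossing; have [->|[-> ak]] := alive_bool s k; first by left; rewrite mul0r.
rewrite mul1r; case: ltP => hk; last by left.
by right; split=> // -[//|i]; exact: ak.
Qed.

Lemma area_ge0 h s k : 0 <= h -> (forall i, (i < k)%N -> 0 <= s i) -> 0 <= area h s k.
Proof. by move=> h0 s0; rewrite mulr_ge0// sumr_ge0// => i _; exact: s0. Qed.

Lemma dom_ge0 lam h K s : 0 <= h -> 0 <= dom lam h K s.
Proof. by move=> h0; rewrite mulr_ge0// sumr_ge0// => i _; rewrite mulr_ge0// expR_ge0. Qed.

Lemma dom_le lam h K L s : 0 <= h -> (K <= L)%N -> dom lam h K s <= dom lam h L s.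
Proof.
move=> h0 KL; rewrite ler_wpM2l// -(subnKC KL) big_split_ord/= lerDl.
by rewrite sumr_ge0// => i _; rewrite mulr_ge0// expR_ge0.
Qed.

Lemma area_le_dom lam h k s : 0 <= lam -> 0 <= h ->
  expR (- (lam * (k%:R * h))) * area h s k <= dom lam h k s.
Proof.
move=> l0 h0; rewrite /area /dom mulrCA ler_wpM2l// mulr_sumr ler_sum// => i _.
rewrite (le_trans (ler_wpM2l (expR_ge0 _) (ler_norm _)))// ler_wpM2r// ler_expR lerN2.
by rewrite ler_wpM2l// ler_wpM2r// ler_nat ltnW.
Qed.

Lemma disc_ge0 lam h K s : 0 <= s 0%N -> 0 <= h -> 0 <= disc lam h K s.
Proof.
move=> s0 h0; rewrite sumr_ge0// => k _.
have [->|[-> _ ak]] := crossing_bool k s0; first by rewrite mul0r.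
by rewrite mul1r mulr_ge0 ?expR_ge0// area_ge0// => i; rewrite ltnS; exact: ak.
Qed.

Lemma disc_le_dom lam h K s : 0 <= s 0%N -> 0 <= lam -> 0 <= h ->
  disc lam h K s <= dom lam h K s.
Proof.
move=> s0 l0 h0.
apply: (@le_trans _ _ (\sum_(k < K) crossing s k * dom lam h K s)).
  apply: ler_sum => k _; rewrite ler_wpM2l ?crossing_ge0//.
  by rewrite (le_trans (area_le_dom _ _ l0 h0))// dom_le.
rewrite -mulr_suml -[leRHS]mul1r ler_wpM2r ?sum_crossing_le1 ?dom_ge0//.
Qed.

(** With [r = exp (- l h)], the inequality [r (1 + l h) <= 1] gives [h / (1 - r) <= (1 + l h) / l],
    which is at most [1 + 1 / l] for [h <= 1]. The bound is free of [h] and [K]. *)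
Lemma sum_geom_le (l h : R) K : 0 < l -> 0 < h -> h <= 1 ->
  h * \sum_(j < K) expR (- (l * (j%:R * h))) <= 1 + l^-1.
Proof.
move=> l0 h0 h1; pose r := expR (- (l * h)).
have r0 : 0 < r by exact: expR_gt0.
have lh0 : 0 < l * h by rewrite mulr_gt0.
have rE : r * (1 + l * h) <= 1.
  by rewrite /r expRN mulrC ler_pdivrMr ?expR_gt0// mul1r expR_ge1Dx.
have -> : \sum_(j < K) expR (- (l * (j%:R * h))) = \sum_(j < K) r ^+ j.
  by apply: eq_bigr => j _; rewrite /r -expRM_natl; congr expR; ring.
have geo : (1 - r) * (\sum_(j < K) r ^+ j) <= 1.
  by rewrite -[1 - r]opprB mulNr -subrX1 opprB gerBl exprn_ge0// ltW.
have r1 : 0 < 1 - r by nra.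
set Sg := \sum_(j < K) _ in geo *.
have Sg0 : 0 <= Sg by rewrite sumr_ge0// => j _; rewrite exprn_ge0// ltW.
have key : h <= (1 + l^-1) * (1 - r).
  have lhl : l * h <= l by rewrite ger_pMr.
  have : (1 + l * h) * (1 - r) <= (l + 1) * (1 - r) by apply: ler_wpM2r; lra.
  move=> hh; have {hh} : l * h <= (l + 1) * (1 - r) by apply: le_trans hh; nra.
  move=> hh; rewrite -(ler_pM2l l0) [leRHS]mulrA (_ : l * (1 + l^-1) = l + 1)//.
  by field; rewrite gt_eqF.
have l1 : 0 <= 1 + l^-1 by rewrite addr_ge0// invr_ge0 ltW.
by rewrite (le_trans (ler_wpM2r Sg0 key))// -mulrA -[leRHS]mulr1 ler_wpM2l.
Qed.

(** Half of the rate absorbs the polynomial: [(1 + t)^2 <= 2 + 2 t^2], and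
    [(l t / 2)^2 <= 2 exp (l t / 2)] gives [t^2 <= (8 / l^2) exp (l t / 2)]. *)
Lemma sqr_expR_le (l t : R) : 0 < l -> 0 <= t ->
  (1 + t) ^+ 2 * expR (- (l * t)) <= (2 + 16 / l ^+ 2) * expR (- (l / 2 * t)).
Proof.
move=> l0 t0.
have -> : expR (- (l * t)) = expR (- (l / 2 * t)) * expR (- (l / 2 * t)).
  by rewrite -expRD; congr expR; field.
rewrite mulrA ler_wpM2r ?expR_ge0//.
have u0 : 0 <= l / 2 * t by rewrite mulr_ge0// divr_ge0// ltW.
have := le_fact_expR 2 (l / 2 * t); rewrite ger0_norm// => h2.
have e1 : 1 <= expR (l / 2 * t) by rewrite -[leLHS]expR0 ler_expR.
rewrite expRN ler_pdivrMr ?expR_gt0//.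
have h3 : t ^+ 2 <= 8 / l ^+ 2 * expR (l / 2 * t).
  have -> : t ^+ 2 = 4 / l ^+ 2 * (l / 2 * t) ^+ 2 by field; rewrite gt_eqF.
  rewrite (_ : 8 / l ^+ 2 = 4 / l ^+ 2 * 2); last by ring.
  by rewrite -[leRHS]mulrA ler_wpM2l// divr_ge0// exprn_ge0// ltW.
rewrite (_ : _ * expR _ = 2 * expR (l / 2 * t) + 2 * (8 / l ^+ 2 * expR (l / 2 * t))); last by ring.
by have := sqr_ge0 (1 - t); nra.
Qed.

(** Cauchy-Schwarz with the discount factors as weights, whose total mass is bounded by
    [sum_geom_le]. What remains is linear in the squares [s j ^+ 2], so second moments of the walk
    suffice. *)
Lemma sqr_dom_le lam h K s : 0 < lam -> 0 < h -> h <= 1 ->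
  dom lam h K s ^+ 2 <=
  (1 + lam^-1) * (h * \sum_(j < K) expR (- (lam * (j%:R * h))) * s j ^+ 2).
Proof.
move=> l0 h0 h1; rewrite /dom.
set a := fun j : 'I_K => expR (- (lam * (j%:R * h))).
have cs : (\sum_(j < K) a j * `|s j|) ^+ 2 <= (\sum_(j < K) a j) * (\sum_(j < K) a j * s j ^+ 2).
  rewrite expr2 !big_distrlr/=.
  rewrite -(ler_pM2l (ltr0n R 2)) mulr_natl [leRHS]mulr_natl !mulr2n.
  rewrite [X in _ <= _ + X]exchange_big/= -!big_split/= ler_sum// => i _.
  rewrite -!big_split/= ler_sum// => j _.
  rewrite -(real_normK (num_real (s i))) -(real_normK (num_real (s j))) -subr_ge0.
  rewrite (_ : _ - _ = a i * a j * (`|s i| - `|s j|) ^+ 2); last by ring.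
  by rewrite mulr_ge0 ?sqr_ge0// mulr_ge0 ?expR_ge0.
rewrite exprMn; apply: (@le_trans _ _ (h ^+ 2 * ((\sum_(j < K) a j) * (\sum_(j < K) a j * s j ^+ 2)))).
  by rewrite ler_wpM2l// sqr_ge0.
rewrite (_ : h ^+ 2 * _ = (h * \sum_(j < K) a j) * (h * \sum_(j < K) a j * s j ^+ 2)); last by ring.
apply: ler_wpM2r; last exact: sum_geom_le.
apply: mulr_ge0; first exact: ltW.
apply: sumr_ge0 => i _.
by rewrite mulr_ge0 ?expR_ge0 ?sqr_ge0.
Qed.

End discrete_path.

(** * Overshoot and the discrete martingale *)

Section overshoot.
Context (R : realType).
Implicit Types (c O A a b : R).

Lemma expR_sub1_le (x : R) : expR x - 1 <= x * expR x.
Proof.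
have h := expR_ge1Dx (- x).
have e : expR (- x) * expR x = 1 by rewrite mulrC expRxMexpNx_1.
by have := ler_wpM2r (expR_ge0 x) h; rewrite e; lra.
Qed.

(** Here [- O] is the position just after crossing and [A] the value wanted at position 0. Every
    error term carries a factor [O]; a second one, in the quadratic term, is absorbed by [exp O],
    whence [c + 1]. *)
Lemma overshoot_phi_le c O A a b : 0 <= c -> 0 <= O -> 0 <= A -> 0 <= a -> 0 <= b ->
  `|expR (c * O) * (A + a * O ^+ 2 - b * O) - A| <=
  O * expR ((c + 1) * O) * (c * A + (a + b)).
Proof.
move=> c0 O0 A0 a0 b0; rewrite mulrDl mul1r expRD.
set e := expR (c * O); set f := expR O.
have e1 : 1 <= e by rewrite -[leLHS]expR0 ler_expR mulr_ge0.
have f1 : 1 <= f by rewrite -[leLHS]expR0 ler_expR.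
have fO : O <= f by rewrite /f (le_trans _ (expR_ge1Dx _))// lerDr.
have eO : e - 1 <= c * O * e by exact: expR_sub1_le.
have e0 : 0 <= e by exact: expR_ge0.
have t1 : (e - 1) * A <= c * O * e * A by rewrite ler_wpM2r.
have t2 : c * O * e * A <= c * O * e * A * f by rewrite ler_peMr// !mulr_ge0.
have t3 : e * (a * O) * O <= e * (a * O) * f by rewrite ler_wpM2l// !mulr_ge0.
have t4 : e * b * O <= e * b * O * f by rewrite ler_peMr// !mulr_ge0.
have s1 : 0 <= (e - 1) * A by rewrite mulr_ge0// subr_ge0.
have s3 : 0 <= e * (a * O) * O by rewrite !mulr_ge0.
have s4 : 0 <= e * b * O by rewrite !mulr_ge0.
rewrite (_ : e * _ - A = (e - 1) * A + e * (a * O) * O - e * b * O); last by ring.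
rewrite (_ : O * (e * f) * _ = c * O * e * A * f + e * (a * O) * f + e * b * O * f); last by ring.
by rewrite ler_norml; apply/andP; split; lra.
Qed.

(** For [O <= dl] the first term suffices. Otherwise [O <= |xi|^4 / dl^3 = h^2 u^4 / dl^3] with
    [u = |xi| / sqrt h], and [u^4 <= 4! exp u]. The fourth power is taken because the bound is later
    summed over [K] steps: [K h] is the horizon, so a factor [h] must be left over. *)
Lemma overshoot_le (c O dl h xi : R) : 0 <= c -> 0 <= O -> 0 < dl -> dl <= 1 -> 0 < h -> h <= 1 ->
  O <= `|xi| ->
  O * expR (c * O) <= dl * expR c + 24 * h ^+ 2 / dl ^+ 3 *
    (expR ((c + 1) / Num.sqrt h * xi) + expR (- ((c + 1) / Num.sqrt h * xi))).
Proof.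
move=> c0 O0 dl0 dl1 h0 h1 Oxi.
set W := expR _ + expR _.
have W0 : 0 <= W by rewrite addr_ge0// expR_ge0.
have q0 : 0 <= 24 * h ^+ 2 / dl ^+ 3 * W.
  by rewrite mulr_ge0// divr_ge0// ?mulr_ge0 ?exprn_ge0// ltW.
have d0 : 0 <= dl * expR c by rewrite mulr_ge0 ?expR_ge0// ltW.
have [Odl|dlO] := lerP O dl.
  rewrite (@le_trans _ _ (dl * expR c))//; last by rewrite lerDl.
  by rewrite ler_pM ?expR_ge0// ler_expR ler_piMr// (le_trans Odl).
rewrite (@le_trans _ _ (24 * h ^+ 2 / dl ^+ 3 * W))//; last by rewrite lerDr.
have O4 : O <= `|xi| ^+ 4 / dl ^+ 3.
  rewrite ler_pdivlMr ?exprn_gt0//.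
  have -> : `|xi| ^+ 4 = `|xi| * `|xi| ^+ 3 by rewrite exprS.
  apply: ler_pM => //; first by rewrite exprn_ge0// ltW.
  by rewrite lerXn2r ?nnegrE ?(ltW dl0)// (le_trans (ltW dlO)).
have s0 : 0 < Num.sqrt h by rewrite sqrtr_gt0.
have s1 : Num.sqrt h <= 1 by rewrite -[leRHS]sqrtr1 ler_wsqrtr.
have ss : Num.sqrt h ^+ 2 = h by rewrite sqr_sqrtr// ltW.
set u := `|xi| / Num.sqrt h.
have u0 : 0 <= u by rewrite divr_ge0// ltW.
have xiu : `|xi| = Num.sqrt h * u by rewrite /u mulrC divfK// gt_eqF.
have u4 : u ^+ 4 <= 24 * expR u.
  by have := le_fact_expR 4 u; rewrite ger0_norm.
have uxi : `|xi| <= u by rewrite xiu ler_piMl.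
have eW : expR ((c + 1) * u) <= W.
  have := expR_abs_le ((c + 1) / Num.sqrt h * xi); apply: le_trans.
  rewrite ler_expR normrM ger0_norm; last by rewrite divr_ge0 ?addr_ge0// ltW.
  by rewrite /u mulrAC mulrA.
apply: (@le_trans _ _ (`|xi| ^+ 4 / dl ^+ 3 * expR (c * u))).
  apply: ler_pM => //; rewrite ?expR_ge0//.
  by rewrite ler_expR ler_wpM2l// (le_trans Oxi).
have -> : `|xi| ^+ 4 / dl ^+ 3 * expR (c * u) = h ^+ 2 / dl ^+ 3 * (u ^+ 4 * expR (c * u)).
  have s4 : Num.sqrt h ^+ 4 = h ^+ 2 by rewrite -{2}ss -exprM.
  have -> : `|xi| ^+ 4 = h ^+ 2 * u ^+ 4 by rewrite xiu exprMn s4.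
  move: (u ^+ 4) (expR (c * u)) (h ^+ 2) (dl ^+ 3)^-1 => p r a b.
  by ring.
have -> : 24 * h ^+ 2 / dl ^+ 3 * W = h ^+ 2 / dl ^+ 3 * (24 * W) by ring.
apply: ler_wpM2l; first by rewrite divr_ge0// exprn_ge0// ltW.
apply: (@le_trans _ _ (24 * expR u * expR (c * u))); first by rewrite ler_wpM2r ?expR_ge0.
by rewrite -mulrA ler_wpM2l// -expRD (_ : u + c * u = (c + 1) * u)//; ring.
Qed.

End overshoot.

(** * Optional stopping for the Gaussian walk *)

Section walk.
Context d (T : measurableType d) (R : realType).
Variable P : probability T R.
Local Notation Ex f := (\int[P]_x f x)%R.
Local Notation integ f := (P.-integrable setT (EFin \o f)).

Variables (mu h y q : R) (Z : nat -> T -> R).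
Hypotheses (mu0 : 0 < mu) (h0 : 0 < h) (h1 : h <= 1) (y0 : 0 < y) (q0 : 0 <= q).
Hypothesis mZ : forall i, measurable_fun setT (Z i).
Hypothesis indepZ : forall n (A : nat -> set R), (forall i, measurable (A i)) ->
  P (\bigcap_(i in `I_n) Z i @^-1` A i) = (\prod_(i < n) P (Z i @^-1` A i))%E.
Hypothesis lawZ : forall i A, measurable A ->
  pushforward P (Z i) A = normal_prob 0 (Num.sqrt h) A.

Definition walk (w : T) (k : nat) : R := y + \sum_(i < k) (Z i w - mu * h).

Hypothesis walk2 : forall k, integ (fun w => walk w k ^+ 2) /\
  Ex (fun w => walk w k ^+ 2) <= q * (1 + k%:R * h) ^+ 2.

Lemma walk0 w : walk w 0 = y. Proof. by rewrite /walk big_ord0 addr0. Qed.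

Lemma walkS w k : walk w k.+1 = walk w k + (Z k w - mu * h).
Proof. by rewrite /walk big_ord_recr/= addrA. Qed.

(** The cylinders over the increments [Z 0] to [Z (k - 1)], a pi-system generating the past at step
    [k]. *)
Let G k : set (set T) :=
  [set X | exists A : nat -> set R, (forall i, measurable (A i)) /\
     X = \bigcap_(i in `I_k) Z i @^-1` A i].

Let mpre i (A : set R) : measurable A -> measurable (Z i @^-1` A).
Proof. by move=> mA; rewrite -[X in measurable X]setTI; exact: mZ. Qed.

Let Gm k : G k `<=` measurable.
Proof.
move=> _ [A [mA ->]]; apply: bigcap_measurableType => i _; exact: mpre.
Qed.

Let GI k : setI_closed (G k).
Proof.
move=> _ _ [A [mA ->]] [B [mB ->]]; exists (fun i => A i `&` B i); split.
  by move=> i; exact: measurableI.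
by rewrite -bigcapI; apply: eq_bigcapr.
Qed.

Let GT k : G k setT.
Proof.
exists (fun=> setT); split=> //.
by apply/seteqP; split.
Qed.

Let GZ k A D : G k A -> measurable D ->
  P (A `&` Z k @^-1` D) = (P A * P (Z k @^-1` D))%E.
Proof.
move=> [B [mB ->]] mD.
pose B' i := if i == k then D else B i.
have mB' i : measurable (B' i) by rewrite /B'; case: ifP.
have BB' i : (i < k)%N -> B' i = B i by move=> ik; rewrite /B' ltn_eqF.
have B'k : B' k = D by rewrite /B' eqxx.
have E1 := indepZ k.+1 mB'; have E2 := indepZ k mB.
rewrite big_ord_recr/= B'k in E1.
rewrite (_ : _ `&` _ = \bigcap_(i in `I_k.+1) Z i @^-1` B' i).
  rewrite E1 E2; congr (_ * _)%E; apply: eq_bigr => i _.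
  by rewrite BB'.
apply/seteqP; split=> w.
  move=> [w1 w2] i /=; rewrite ltnS leq_eqVlt => /predU1P[->|ik]; first by rewrite B'k.
  by rewrite BB'//; exact: w1.
move=> ww; split; last by have := ww k (ltnSn k); rewrite /= B'k.
by move=> i ik; have := ww i (leqW ik); rewrite /= BB'.
Qed.

Local Notation Fm k U := (@measurable_fun _ _ (g_sigma_algebraType (G k)) R setT U).

Let FmZ k i : (i < k)%N -> Fm k (Z i).
Proof.
move=> ik _ A mA; rewrite setTI; apply: sub_sigma_algebra.
exists (fun j => if j == i then A else setT); split; first by move=> j; case: ifP.
apply/seteqP; split=> w /=.
  by move=> wA j _ /=; case: eqP => // ->.
by move=> /(_ i ik) /=; rewrite eqxx.
Qed.

Let Fmwalk k j : (j <= k)%N -> Fm k (fun w => walk w j).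
Proof.
elim: j => [|j IH] jk.
  rewrite (_ : (fun w => walk w 0) = cst y); first exact: measurable_cst.
  by apply/funext => w; rewrite walk0.
rewrite (_ : (fun w => walk w j.+1) = (fun w => walk w j + (Z j w - mu * h))); last first.
  by apply/funext => w; rewrite walkS.
have := IH (ltnW jk); have := FmZ jk => mZj mj.
by apply: measurable_funD => //; apply: measurable_funB.
Qed.

Let Fm_ind k (U : T -> R) : Fm k U -> Fm k (fun w => (0 <= U w)%R%:R : R).
Proof.
move=> mU.
have mA : @measurable _ (g_sigma_algebraType (G k)) (U @^-1` `[0, +oo[).
  rewrite -[X in measurable X]setTI; apply: mU => //; exact: measurable_itv.
rewrite (_ : (fun _ => _) = \1_(U @^-1` `[0, +oo[)); first exact: measurable_indic.
by apply/funext => w; rewrite indicE; congr (nat_of_bool _)%:R;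
  apply/idP/idP; rewrite ?inE/= in_itv/= andbT.
Qed.

Let Fmalive k j : (j <= k)%N -> Fm k (fun w => alive (walk w) j).
Proof.
elim: j => [|j IH] jk.
  rewrite (_ : (fun w => _) = cst 1); first exact: measurable_cst.
  by apply/funext => w; rewrite alive0.
rewrite (_ : (fun w => _) = (fun w => alive (walk w) j * (0 <= walk w j.+1)%R%:R)); last first.
  by apply/funext => w; rewrite aliveS.
have := IH (ltnW jk); have := Fm_ind (Fmwalk jk) => m1 m2.
exact: measurable_funM.
Qed.

Let Fmsum k n (U : nat -> T -> R) : (forall j, (j < n)%N -> Fm k (U j)) ->
  Fm k (fun w => \sum_(j < n) U j w).
Proof.
elim: n => [|n IH] hU.
  rewrite (_ : (fun w => _) = cst 0); first exact: measurable_cst.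
  by apply/funext => w; rewrite big_ord0.
rewrite (_ : (fun w => _) = (fun w => \sum_(j < n) U j w + U n w)); last first.
  by apply/funext => w; rewrite big_ord_recr.
have m1 := IH (fun j jn => hU j (ltnW jn)); have m2 := hU n (ltnSn n).
exact: measurable_funD.
Qed.

Let Fm_m k (U : T -> R) : Fm k U -> measurable_fun setT U.
Proof.
move=> mU _ A mA; have := mU measurableT A mA.
exact/(smallest_sub (@sigma_algebra_measurable _ T))/Gm.
Qed.

Let mwalk k : measurable_fun setT (fun w => walk w k).
Proof. exact: (Fm_m (Fmwalk (leqnn k))). Qed.

Let malive k : measurable_fun setT (fun w => alive (walk w) k).
Proof. exact: (Fm_m (Fmalive (leqnn k))). Qed.

Let msum n (U : nat -> T -> R) : (forall j, measurable_fun setT (U j)) ->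
  measurable_fun setT (fun w => \sum_(j < n) U j w).
Proof. by move=> mU; exact: measurable_sum. Qed.

Let iwalk k : integ (fun w => walk w k).
Proof. apply: integ_L2; [exact: mwalk|exact: (walk2 k).1]. Qed.

Let iarea k : integ (fun w => area h (walk w) k).
Proof. by apply: integZ; apply: (integ_sum (f := fun j w => walk w j)) => i _; exact: iwalk. Qed.

(** The left Riemann sum lags by one step, so [area] at [k.+1] already belongs to the past at
    [k]. *)
Let Fmarea k j : (j <= k.+1)%N -> Fm k (fun w => area h (walk w) j).
Proof.
move=> jk; apply: measurable_funM; first exact: measurable_cst.
apply: (Fmsum (U := fun j w => walk w j)) => i ij; apply: Fmwalk.
by rewrite -ltnS (leq_trans ij).
Qed.

Lemma walk_indep k (U : T -> R) (g : R -> R) : Fm k U -> measurable_fun setT g ->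
  integ U -> integ (g \o Z k) ->
  integ (fun w => U w * g (Z k w)) /\ Ex (fun w => U w * g (Z k w)) = Ex U * Ex (g \o Z k).
Proof.
by move=> mU mg iU ig; apply: (indep_prod (mZ k) (@Gm k) (@GI k) (@GT k) (@GZ k)).
Qed.

Lemma integ_bddM (b f : T -> R) : measurable_fun setT b -> (forall w, `|b w| <= 1) ->
  integ f -> integ (fun w => b w * f w).
Proof.
move=> mb b1 fi; apply: (@integ_le _ _ _ _ _ (fun w => `|f w|)).
- by apply: measurable_funM => //; exact: integ_measurable fi.
- by apply: integrable_norm.
- by move=> w; rewrite normrM ler_piMl.
Qed.

Variable c : R.
Hypothesis c0 : 0 < c.

(* The constants that make [phi] below a martingale as long as the walk is alive; the term
   [h / 2] in [lin_coef] compensates for [area] being a left Riemann sum. *)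
Definition rate : R := c ^+ 2 / 2 + mu * c.
Definition quad_coef : R := (2 * (c + mu))^-1.
Definition lin_coef : R := (2 * (c + mu) ^+ 2)^-1 + h / 2.
Definition phi k w : R := expR (- (rate * (k%:R * h)) - c * walk w k) *
  (area h (walk w) k + quad_coef * walk w k ^+ 2 + lin_coef * walk w k).

Let cm0 : 0 < c + mu. Proof. by rewrite addr_gt0. Qed.
Lemma rate_gt0 : 0 < rate.
Proof. by rewrite addr_gt0 ?mulr_gt0 ?exprn_gt0 ?invr_gt0. Qed.
Lemma quad_coef_gt0 : 0 < quad_coef. Proof. by rewrite invr_gt0 mulr_gt0. Qed.
Lemma lin_coef_gt0 : 0 < lin_coef.
Proof. by rewrite addr_gt0 ?invr_gt0 ?mulr_gt0 ?exprn_gt0 ?invr_gt0. Qed.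

(** While alive the walk is nonnegative, so this factor lies in [[0, 1]] and multiplying by it
    preserves integrability. *)
Let damp k w := alive (walk w) k * expR (- c * walk w k).

Lemma alive_walk_ge0 w k : alive (walk w) k = 0 \/
  (alive (walk w) k = 1 /\ forall i, (i <= k)%N -> 0 <= walk w i).
Proof.
have [->|[-> ak]] := alive_bool (walk w) k; [by left|right; split=> // -[_|i ik]].
  by rewrite walk0 ltW.
exact: ak.
Qed.

Let damp01 k w : 0 <= damp k w <= 1.
Proof.
rewrite /damp; have [->|[-> ak]] := alive_walk_ge0 w k; first by rewrite mul0r lexx ler01.
rewrite mul1r expR_ge0/= -expR0 ler_expR mulNr oppr_le0 mulr_ge0 ?ak//; exact: ltW.
Qed.

Let damp1 k w : `|damp k w| <= 1.
Proof. by have /andP[? ?] := damp01 k w; rewrite ger0_norm. Qed.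

Let Fmdamp k : Fm k (fun w => damp k w).
Proof.
have m1 := Fmalive (leqnn k); have m2 := Fmwalk (leqnn k).
by apply: measurable_funM => //; apply: measurableT_comp => //; exact: measurable_funM.
Qed.

Let mdamp k : measurable_fun setT (fun w => damp k w).
Proof. by have := Fm_m (@Fmdamp k). Qed.

Let Zexp_int k n t : integ (fun w => Z k w ^+ n * expR (t * Z k w)).
Proof. exact: (normal_integ_polyexp (mZ k) h0 (@lawZ k)). Qed.

Let Zpow_indep k n (U : T -> R) : Fm k U -> integ U ->
  integ (fun w => U w * (Z k w ^+ n * expR (- c * Z k w))) /\
  Ex (fun w => U w * (Z k w ^+ n * expR (- c * Z k w))) =
  Ex U * Ex (fun w => Z k w ^+ n * expR (- c * Z k w)).
Proof.
move=> mU iU; apply: (@walk_indep k U (fun z => z ^+ n * expR (- c * z))) => //.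
  apply: measurable_funM; first exact: measurable_funX.
  by apply: measurableT_comp => //; exact: measurable_funM.
exact: Zexp_int.
Qed.

(** After one step [phi] is a quadratic polynomial in [Z k], times [exp (- c * Z k)], with
    coefficients from the past; independence replaces the powers of [Z k] by tilted Gaussian
    moments. Under the tilt a step has mean [- (c + mu) h] and variance [h]. Comparing coefficients
    of the position forces [2 (c + mu) quad_coef = 1] and
    [lin_coef = quad_coef / (c + mu) + h / 2]. *)
Lemma phi_alive_step k :
  [/\ integ (fun w => alive (walk w) k * phi k w),
      integ (fun w => alive (walk w) k * phi k.+1 w) &
  Ex (fun w => alive (walk w) k * phi k.+1 w) = Ex (fun w => alive (walk w) k * phi k w)].
Proof.
pose s' w := walk w k - mu * h.
pose V0 w := area h (walk w) k + h * walk w k + quad_coef * s' w ^+ 2 + lin_coef * s' w.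
pose V1 w := 2 * quad_coef * s' w + lin_coef.
pose V2 (w : T) := quad_coef.
pose V w := area h (walk w) k + quad_coef * walk w k ^+ 2 + lin_coef * walk w k.
have FW := Fmwalk (leqnn k); have FA := Fmarea (leqnSn k).
have Fs' : Fm k s' by apply: measurable_funB.
have FV0 : Fm k V0.
  by apply: measurable_funD; [apply: measurable_funD; [apply: measurable_funD|]|];
    do ?[exact: FA|apply: measurable_funM|apply: measurable_funX|exact: measurable_cst].
have FV1 : Fm k V1 by apply: measurable_funD => //; apply: measurable_funM.
have FV2 : Fm k V2 by exact: measurable_cst.
have is' : integ s' by apply: (integD (iwalk k)); exact: integ_cst.
have is'2 : integ (fun w => s' w ^+ 2).
  apply: (@integ_L2D _ _ _ _ (fun w => walk w k) (fun=> - (mu * h))) => //.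
  - exact: (walk2 k).1.
  - exact: integ_cst.
have iV : integ V.
  by apply: integD; [apply: integD => //; apply: integZ; exact: (walk2 k).1|exact: integZ].
have iV0 : integ V0.
  apply: integD; last exact: integZ.
  by apply: integD; [apply: integD => //; exact: integZ|exact: integZ].
have iV1 : integ V1 by apply: integD; [exact: integZ|exact: integ_cst].
have iV2 : integ V2 by exact: integ_cst.
have dint (U : T -> R) : integ U -> integ (fun w => damp k w * U w).
  by move=> iU; apply: integ_bddM.
have dF (U : T -> R) : Fm k U -> Fm k (fun w => damp k w * U w).
  by move=> FU; have := @Fmdamp k => Fd; exact: measurable_funM.
pose m0 : R := expR (c ^+ 2 * h / 2).
have M0 : Ex (fun w => Z k w ^+ 0 * expR (- c * Z k w)) = m0.
  under eq_Rintegral do rewrite expr0 mul1r.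
  by rewrite (normal_Ex_exp (mZ k) h0 (@lawZ k)) sqrrN.
have M1 : Ex (fun w => Z k w ^+ 1 * expR (- c * Z k w)) = - c * h * m0.
  by rewrite (normal_Ex_Zexp (mZ k) h0 (@lawZ k)) sqrrN.
have M2 : Ex (fun w => Z k w ^+ 2 * expR (- c * Z k w)) = (h + c ^+ 2 * h ^+ 2) * m0.
  by rewrite (normal_Ex_Z2exp (mZ k) h0 (@lawZ k)) sqrrN.
have [i0 E0] := Zpow_indep 0 (dF _ FV0) (dint _ iV0).
have [i1 E1] := Zpow_indep 1 (dF _ FV1) (dint _ iV1).
have [i2 E2] := Zpow_indep 2 (dF _ FV2) (dint _ iV2).
pose kap := expR (- (rate * (k.+1%:R * h)) + c * (mu * h)).
have stepE : (fun w => alive (walk w) k * phi k.+1 w) =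
  (fun w => kap * ((damp k w * V0 w) * (Z k w ^+ 0 * expR (- c * Z k w)) +
                   (damp k w * V1 w) * (Z k w ^+ 1 * expR (- c * Z k w)) +
                   (damp k w * V2 w) * (Z k w ^+ 2 * expR (- c * Z k w)))).
  apply/funext => w; rewrite /phi.
  have -> : area h (walk w) k.+1 = area h (walk w) k + h * walk w k.
    by rewrite /area big_ord_recr/= mulrDr.
  rewrite walkS.
  rewrite (_ : expR _ = kap * (expR (- c * walk w k) * expR (- c * Z k w))); last first.
    by rewrite /kap -!expRD; congr expR; ring.
  by rewrite /damp /V0 /V1 /V2 /s'; ring.
have phiE : (fun w => alive (walk w) k * phi k w) =
  (fun w => expR (- (rate * (k%:R * h))) * (damp k w * V w)).
  apply/funext => w; rewrite /phi /damp /V.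
  by rewrite expRD mulNr; ring.
have isum : integ (fun w => (damp k w * V0 w) * (Z k w ^+ 0 * expR (- c * Z k w)) +
                   (damp k w * V1 w) * (Z k w ^+ 1 * expR (- c * Z k w)) +
                   (damp k w * V2 w) * (Z k w ^+ 2 * expR (- c * Z k w))).
  by apply: integD => //; exact: integD.
split.
- by rewrite phiE; apply: integZ; exact: dint.
- by rewrite stepE; exact: integZ.
rewrite stepE phiE ExZ// ExD//; last exact: integD.
rewrite ExD// E0 E1 E2 M0 M1 M2.
rewrite [in RHS]ExZ; last exact: dint.
(* This identity determines [rate]: one step of discount cancels the exponential moment
   [exp (c^2 h / 2 + c mu h)]. *)
have kapE : kap * m0 = expR (- (rate * (k%:R * h))).
  by rewrite /kap /m0 -expRD /rate; congr expR; rewrite -natr1; field.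
rewrite -kapE.
have EV : Ex (fun w => damp k w * V w) =
  Ex (fun w => damp k w * V0 w) + (- c * h) * Ex (fun w => damp k w * V1 w) +
  (h + c ^+ 2 * h ^+ 2) * Ex (fun w => damp k w * V2 w).
  have d1 := dint _ iV1; have d2 := dint _ iV2.
  have d0 := dint _ iV0; have z1 := integZ (- c * h) d1.
  have z2 := integZ (h + c ^+ 2 * h ^+ 2) d2; have z01 := integD d0 z1.
  rewrite -(ExZ _ d1) -(ExZ _ d2) -(ExD d0 z1) -(ExD z01 z2).
  apply: eq_Rintegral => w _; rewrite /V /V0 /V1 /V2 /s' /lin_coef /quad_coef.
  by field; rewrite gt_eqF.
by rewrite EV; ring.
Qed.

(** The first factor is the mass of the Cauchy-Schwarz weights, the rest bounds the discounted sum
    of second moments after half of the rate is spent on [(1 + t)^2]. Neither [h] nor [K] occurs. *)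
Definition dom2_bound : R := (1 + rate^-1) * (q * ((2 + 16 / rate ^+ 2) * (1 + (rate / 2)^-1))).

Lemma dom2_bound_ge0 : 0 <= dom2_bound.
Proof.
have r0 := rate_gt0.
by rewrite /dom2_bound !mulr_ge0// addr_ge0// ?divr_ge0 ?invr_ge0 ?exprn_ge0 ?divr_ge0// ltW.
Qed.

Let mdom K : measurable_fun setT (fun w => dom rate h K (walk w)).
Proof.
apply: measurable_funM => //.
apply: (@msum K (fun j w => expR (- (rate * (j%:R * h))) * `|walk w j|)) => j.
by apply: measurable_funM => //; exact: measurableT_comp.
Qed.

Lemma dom_L2 K : integ (fun w => dom rate h K (walk w) ^+ 2) /\
  Ex (fun w => dom rate h K (walk w) ^+ 2) <= dom2_bound.
Proof.
have r0 := rate_gt0.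
pose D2 w := (1 + rate^-1) * (h * \sum_(j < K) expR (- (rate * (j%:R * h))) * walk w j ^+ 2).
have ij j : integ (fun w => expR (- (rate * (j%:R * h))) * walk w j ^+ 2).
  by apply: integZ; exact: (walk2 j).1.
have isum : integ (fun w => \sum_(j < K) expR (- (rate * (j%:R * h))) * walk w j ^+ 2).
  by apply: (integ_sum (f := fun j w => expR (- (rate * (j%:R * h))) * walk w j ^+ 2)) => j _.
have iD2 : integ D2 by do 2 apply: integZ.
have le2 w : dom rate h K (walk w) ^+ 2 <= D2 w by exact: sqr_dom_le.
have i2 : integ (fun w => dom rate h K (walk w) ^+ 2).
  apply: (integ_le _ iD2); first by apply: measurable_funX; exact: mdom.
  by move=> w; rewrite ger0_norm ?sqr_ge0.
split=> //; apply: (le_trans (Ex_le i2 iD2 le2)).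
rewrite /D2 ExZ; last exact: integZ.
rewrite ExZ// (Ex_sum (f := fun j w => expR (- (rate * (j%:R * h))) * walk w j ^+ 2)) => [|j _//].
rewrite /dom2_bound; apply: ler_wpM2l; first by rewrite addr_ge0// invr_ge0 ltW.
apply: (@le_trans _ _ (h * \sum_(j < K) q * ((2 + 16 / rate ^+ 2) * expR (- (rate / 2 * (j%:R * h)))))).
  apply: ler_wpM2l; first exact: ltW.
  apply: ler_sum => j _; rewrite ExZ; last exact: (walk2 j).1.
  apply: (le_trans (ler_wpM2l (expR_ge0 _) (walk2 j).2)).
  rewrite mulrCA ler_wpM2l// mulrC sqr_expR_le// mulr_ge0//; exact: ltW.
rewrite -mulr_sumr -mulr_sumr.
rewrite (_ : h * _ = q * ((2 + 16 / rate ^+ 2) * (h * \sum_(i < K) expR (- (rate / 2 * (i%:R * h)))))); last by ring.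
apply: ler_wpM2l => //; apply: ler_wpM2l.
  by rewrite addr_ge0// divr_ge0// exprn_ge0// ltW.
by apply: sum_geom_le => //; rewrite divr_gt0.
Qed.

Lemma dom_L1 K : integ (fun w => dom rate h K (walk w)) /\
  Ex (fun w => dom rate h K (walk w)) <= 1 + dom2_bound.
Proof.
have [i2 E2] := dom_L2 K.
have i1 : integ (fun w => dom rate h K (walk w)) by apply: integ_L2 => //; exact: mdom.
split=> //; apply: (@le_trans _ _ (Ex (fun w => 1 + dom rate h K (walk w) ^+ 2))).
  apply: Ex_le => //; first by apply: integD => //; exact: integ_cst.
  by move=> w; have := dom_ge0 rate K (walk w) (ltW h0); nra.
by rewrite ExD ?Ex_cst ?lerD2l//; exact: integ_cst.
Qed.

Let mcross k : measurable_fun setT (fun w => crossing (walk w) k).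
Proof.
rewrite (_ : (fun w => _) = (fun w => alive (walk w) k - alive (walk w) k.+1)).
  exact: measurable_funB.
by apply/funext => w; rewrite crossingE.
Qed.

Let marea k : measurable_fun setT (fun w => area h (walk w) k).
Proof. exact: integ_measurable (@iarea k). Qed.

Lemma disc_measurable K : measurable_fun setT (fun w => disc rate h K (walk w)).
Proof.
apply: (@msum K (fun k w => crossing (walk w) k * (expR (- (rate * (k.+1%:R * h))) * area h (walk w) k.+1))) => k.
by apply: measurable_funM => //; exact: measurable_funM.
Qed.

Let walk00 w : 0 <= walk w 0. Proof. by rewrite walk0 ltW. Qed.

Lemma disc_walk_ge0 K w : 0 <= disc rate h K (walk w).
Proof. by rewrite disc_ge0// ltW. Qed.

Let disc_dom K w : disc rate h K (walk w) <= dom rate h K (walk w).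
Proof. by rewrite disc_le_dom// ltW// rate_gt0. Qed.

Lemma disc_L2 K : integ (fun w => disc rate h K (walk w) ^+ 2) /\
  Ex (fun w => disc rate h K (walk w) ^+ 2) <= dom2_bound.
Proof.
have [i2 E2] := dom_L2 K.
have le2 w : disc rate h K (walk w) ^+ 2 <= dom rate h K (walk w) ^+ 2.
  by rewrite lerXn2r ?nnegrE ?disc_walk_ge0// (le_trans (disc_walk_ge0 _ _) (disc_dom _ _)).
have i : integ (fun w => disc rate h K (walk w) ^+ 2).
  apply: (integ_le _ i2); first by apply: measurable_funX; exact: disc_measurable.
  by move=> w; rewrite ger0_norm ?sqr_ge0.
by split=> //; apply: le_trans E2; exact: Ex_le.
Qed.

Let icross_phi k : integ (fun w => crossing (walk w) k * phi k.+1 w).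
Proof.
have [_ i1 _] := phi_alive_step k; have [i2 _ _] := phi_alive_step k.+1.
rewrite (_ : (fun w => _) = (fun w => alive (walk w) k * phi k.+1 w + -1 * (alive (walk w) k.+1 * phi k.+1 w))).
  by apply: integD => //; exact: integZ.
by apply/funext => w; rewrite crossingE; ring.
Qed.

(** Optional stopping by induction: at each step the alive part splits into the part that crosses
    and the part that survives, and [phi_alive_step] preserves the total. *)
Lemma phi_telescope K :
  expR (- (c * y)) * (quad_coef * y ^+ 2 + lin_coef * y) =
  Ex (fun w => alive (walk w) K * phi K w) +
  \sum_(k < K) Ex (fun w => crossing (walk w) k * phi k.+1 w).
Proof.
elim: K => [|K IH].
  rewrite big_ord0 addr0 -[LHS](Ex_cst P); apply: eq_Rintegral => w _.
  rewrite alive0 /phi walk0 mul1r /area big_ord0 mulr0 add0r mul0r mulr0 oppr0 sub0r.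
  by [].
rewrite IH big_ord_recr/= [X in _ = _ + X]addrC addrA; congr (_ + _).
have [_ i1 <-] := phi_alive_step K; have [i2 _ _] := phi_alive_step K.+1.
rewrite -ExD//; apply: eq_Rintegral => w _.
by rewrite crossingE; ring.
Qed.

Section error.
Variable dl : R.
Hypotheses (dl0 : 0 < dl) (dl1 : dl <= 1).

(** [overshoot_le] is applied with [c + 1], the exponent left by [overshoot_phi_le], and adds
    another 1. *)
Let slope := (c + 2) / Num.sqrt h.
Let gW (z : R) := expR (slope * (z - mu * h)) + expR (- (slope * (z - mu * h))).
Let kappa := 24 * h ^+ 2 / dl ^+ 3.
(** The contribution of overshoots below [dl]. It keeps the factor [crossing], so its sum over [k]
    does not grow with [K]. *)
Let err1 k w := dl * expR (c + 1) *
  (c * (crossing (walk w) k * (expR (- (rate * (k.+1%:R * h))) * area h (walk w) k.+1)) +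
   (quad_coef + lin_coef) * crossing (walk w) k).
(** The contribution of overshoots above [dl]. The factor [crossing], which depends on [Z k], is
    dropped, so that a quantity from the past is multiplied by an independent function of [Z k]. *)
Let err2 k w := kappa * ((c * dom rate h k.+1 (walk w) + (quad_coef + lin_coef)) * gW (Z k w)).

Let dm_ge0 k w : 0 <= c * dom rate h k.+1 (walk w) + (quad_coef + lin_coef).
Proof.
have c2 := quad_coef_gt0; have c1 := lin_coef_gt0.
apply: addr_ge0; last by apply: addr_ge0; exact: ltW.
by apply: mulr_ge0; [exact: ltW|apply: dom_ge0; exact: ltW].
Qed.

Let err_le k w :
  `|crossing (walk w) k * phi k.+1 w -
    crossing (walk w) k * (expR (- (rate * (k.+1%:R * h))) * area h (walk w) k.+1)| <=
  err1 k w + err2 k w.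
Proof.
have c2 := quad_coef_gt0; have c1 := lin_coef_gt0; have r0 := rate_gt0.
have kap0 : 0 <= kappa by rewrite /kappa divr_ge0 ?mulr_ge0 ?exprn_ge0// ltW.
have gW0 : 0 <= gW (Z k w) by rewrite addr_ge0// expR_ge0.
have dm0 := @dm_ge0 k w.
rewrite /err1 /err2; have [->|[-> sk ak]] := crossing_bool k (walk00 w).
  rewrite !(mul0r, mulr0, subrr, normr0, addr0, add0r, oppr0).
  exact: (mulr_ge0 kap0 (mulr_ge0 dm0 gW0)).
rewrite !mul1r mulr1.
set O := - walk w k.+1.
have O0 : 0 <= O by rewrite oppr_ge0 ltW.
set A := area h (walk w) k.+1.
have A0 : 0 <= A by apply: area_ge0; [exact: ltW|move=> i; rewrite ltnS; exact: ak].
set E := expR (- (rate * (k.+1%:R * h))).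
have E0 : 0 <= E by exact: expR_ge0.
have E1 : E <= 1.
  by rewrite /E -expR0 ler_expR oppr_le0 !mulr_ge0// ltW.
have -> : phi k.+1 w - E * A = E * (expR (c * O) * (A + quad_coef * O ^+ 2 - lin_coef * O) - A).
  by rewrite /phi -/A expRD -/E -mulrN -/O (_ : walk w k.+1 = - O) ?/O ?opprK//; ring.
(* The walk is still nonnegative at step [k], so the overshoot is at most the size of the last
   increment. *)
have Oxi : O <= `|Z k w - mu * h|.
  have := ak k (leqnn k); rewrite /O walkS => wk.
  by rewrite -normrN (le_trans _ (ler_norm _))//; lra.
rewrite normrM (ger0_norm E0).
apply: (le_trans (ler_wpM2l E0 (overshoot_phi_le (ltW c0) O0 A0 (ltW c2) (ltW c1)))).
have ov := overshoot_le (addr_ge0 (ltW c0) ler01) O0 dl0 dl1 h0 h1 Oxi.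
rewrite (_ : c + 1 + 1 = c + 2) in ov; last by ring.
rewrite -/kappa -/slope -/(gW (Z k w)) in ov.
have EA : E * A <= dom rate h k.+1 (walk w) by apply: area_le_dom; exact: ltW.
have cEA0 : 0 <= E * (c * A + (quad_coef + lin_coef)).
  apply: mulr_ge0 => //; apply: addr_ge0; last by apply: addr_ge0; exact: ltW.
  by apply: mulr_ge0 => //; exact: ltW.
rewrite [leLHS]mulrCA.
apply: (le_trans (ler_wpM2r cEA0 ov)); rewrite mulrDl.
have ub1 : E * (c * A + (quad_coef + lin_coef)) <= c * (E * A) + (quad_coef + lin_coef).
  by rewrite mulrDr mulrCA lerD2l ler_piMl//; apply: addr_ge0; exact: ltW.
have ub2 : E * (c * A + (quad_coef + lin_coef)) <= c * dom rate h k.+1 (walk w) + (quad_coef + lin_coef).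
  by rewrite (le_trans ub1)// lerD2r ler_wpM2l// ltW.
apply: lerD; first by apply: ler_wpM2l => //; rewrite mulr_ge0 ?expR_ge0// ltW.
rewrite -mulrA; apply: ler_wpM2l => //; rewrite mulrC; exact: ler_wpM2r.
Qed.

(** Free of [h]: the variance [h] cancels in [slope ^+ 2 * h = (c + 2) ^+ 2], and the drift
    contributes [slope * (mu * h) <= (c + 2) * mu]. *)
Let Cb := expR ((c + 2) ^+ 2 / 2 + (c + 2) * mu).

Let gW_int k : integ (gW \o Z k) /\ Ex (gW \o Z k) <= 2 * Cb.
Proof.
have s0 : 0 < Num.sqrt h by rewrite sqrtr_gt0.
have ss : Num.sqrt h ^+ 2 = h by rewrite sqr_sqrtr// ltW.
have ex t : integ (fun w => expR (t * Z k w)) /\ Ex (fun w => expR (t * Z k w)) = expR (t ^+ 2 * h / 2).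
  exact: (normal_rv_mgf t (mZ k) h0 (@lawZ k)).
have gE : gW \o Z k = (fun w => expR (- (slope * (mu * h))) * expR (slope * Z k w) +
   expR (slope * (mu * h)) * expR (- slope * Z k w)).
  apply/funext => w; rewrite /gW/= -!expRD; congr (expR _ + expR _); ring.
have i1 := integZ (expR (- (slope * (mu * h)))) (ex slope).1.
have i2 := integZ (expR (slope * (mu * h))) (ex (- slope)).1.
rewrite gE; split; first exact: integD.
rewrite ExD// !ExZ ?(ex _).1// !(ex _).2 sqrrN.
have -> : slope ^+ 2 * h = (c + 2) ^+ 2.
  by rewrite /slope exprMn exprVn ss divfK// gt_eqF.
have smh : slope * (mu * h) <= (c + 2) * mu.
  rewrite /slope -{2}ss expr2 (_ : _ * _ = (c + 2) * mu * Num.sqrt h).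
    by rewrite ler_piMr ?mulr_ge0 ?addr_ge0 ?(ltW c0) ?(ltW mu0)// -[leRHS]sqrtr1 ler_wsqrtr.
  by field; rewrite gt_eqF.
have smh0 : 0 <= slope * (mu * h).
  by rewrite !mulr_ge0 ?addr_ge0 ?invr_ge0// ltW.
rewrite -!expRD mulr2n mulrDl mul1r lerD// ler_expR /Cb addrC lerD2l//.
by rewrite (le_trans _ smh)// ge0_cp.
Qed.

Let Fmdom k : Fm k (fun w => dom rate h k.+1 (walk w)).
Proof.
apply: measurable_funM; first exact: measurable_cst.
apply: (@Fmsum k k.+1 (fun j w => expR (- (rate * (j%:R * h))) * `|walk w j|)) => j jk.
apply: measurable_funM; first exact: measurable_cst.
by apply: measurableT_comp => //; apply: Fmwalk.
Qed.

Let icrossA k : integ (fun w => crossing (walk w) k * (expR (- (rate * (k.+1%:R * h))) * area h (walk w) k.+1)).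
Proof.
apply: integ_bddM => //; last exact: integZ.
move=> w; have [->|[-> _ _]] := crossing_bool k (walk00 w); first by rewrite normr0.
by rewrite normr1.
Qed.

Let icross k : integ (fun w => crossing (walk w) k).
Proof.
rewrite (_ : (fun w => _) = (fun w => crossing (walk w) k * 1)); last by apply/funext => w; rewrite mulr1.
apply: integ_bddM => //; last exact: integ_cst.
move=> w; have [->|[-> _ _]] := crossing_bool k (walk00 w); first by rewrite normr0.
by rewrite normr1.
Qed.

Let err2_int k : integ (err2 k) /\
  Ex (err2 k) <= kappa * ((c * (1 + dom2_bound) + (quad_coef + lin_coef)) * (2 * Cb)).
Proof.
have c2 := quad_coef_gt0; have c1 := lin_coef_gt0.
have kap0 : 0 <= kappa by rewrite /kappa divr_ge0 ?mulr_ge0 ?exprn_ge0// ltW.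
have [id Ed] := dom_L1 k.+1; have [ig Eg] := gW_int k.
have iU : integ (fun w => c * dom rate h k.+1 (walk w) + (quad_coef + lin_coef)).
  by apply: integD; [exact: integZ|exact: integ_cst].
have [|||//|i E] := @walk_indep k (fun w => c * dom rate h k.+1 (walk w) + (quad_coef + lin_coef)) gW.
- apply: measurable_funD; last exact: measurable_cst.
  by apply: measurable_funM; [exact: measurable_cst|exact: Fmdom].
- have ml : measurable_fun setT (fun z : R => slope * (z - mu * h)).
    by apply: measurable_funM => //; exact: measurable_funB.
  apply: measurable_funD; first exact: (measurableT_comp (f := expR)).
  by apply: (measurableT_comp (f := expR)) => //; exact: measurableT_comp.
- by [].
split; first exact: integZ.
rewrite /err2 ExZ// E; apply: ler_wpM2l => //.
apply: ler_pM => //.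
- by apply: Rintegral_ge0 => w _; exact: dm_ge0.
- by apply: Rintegral_ge0 => w _; rewrite addr_ge0 ?expR_ge0.
rewrite ExD ?Ex_cst//; [|exact: integZ|exact: integ_cst].
by rewrite lerD2r ExZ// ler_wpM2l// ltW.
Qed.

(** [phi_telescope] compares the starting value with [phi] at the crossing. Replacing [phi] there by
    the discounted area costs [err1], at most one crossing in total, and [err2], once for each of
    the [K] steps. *)
Lemma Ex_disc_error K :
  `|Ex (fun w => disc rate h K (walk w)) - expR (- (c * y)) * (quad_coef * y ^+ 2 + lin_coef * y)| <=
  Ex (fun w => alive (walk w) K * phi K w) +
  (c * (1 + dom2_bound) + (quad_coef + lin_coef)) *
    (dl * expR (c + 1) + K%:R * (kappa * (2 * Cb))).
Proof.
have c2 := quad_coef_gt0; have c1 := lin_coef_gt0; have r0 := rate_gt0.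
set B := c * (1 + dom2_bound) + (quad_coef + lin_coef).
pose t1 k w := crossing (walk w) k * phi k.+1 w.
pose t2 k w := crossing (walk w) k * (expR (- (rate * (k.+1%:R * h))) * area h (walk w) k.+1).
have it2 k : integ (t2 k) by exact: icrossA.
have it1 k : integ (t1 k) by exact: icross_phi.
have ierr1 k : integ (err1 k).
  by apply: integZ; apply: integD; apply: integZ.
have idsc : integ (fun w => disc rate h K (walk w)) by apply: (integ_sum (f := t2)).
have dE : Ex (fun w => disc rate h K (walk w)) = \sum_(k < K) Ex (t2 k) by exact: (Ex_sum (f := t2)).
have al0 : 0 <= Ex (fun w => alive (walk w) K * phi K w).
  apply: Rintegral_ge0 => w _; have [->|[-> ak]] := alive_walk_ge0 w K; first by rewrite mul0r.
  have A0 : 0 <= area h (walk w) K by apply: area_ge0; [exact: ltW|move=> i /ltnW; exact: ak].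
  have w0 := ak K (leqnn K).
  rewrite mul1r /phi mulr_ge0 ?expR_ge0//.
  by apply: addr_ge0; [apply: addr_ge0 => //|]; apply: mulr_ge0; rewrite ?sqr_ge0//; exact: ltW.
have bnd k : `|Ex (t2 k) - Ex (t1 k)| <= Ex (err1 k) + Ex (err2 k).
  have [ie2 _] := err2_int k.
  have idiff : integ (fun w => t1 k w + -1 * t2 k w) by apply: integD => //; exact: integZ.
  have -> : Ex (t2 k) - Ex (t1 k) = - Ex (fun w => t1 k w + -1 * t2 k w).
    by rewrite ExD ?ExZ//; [ring|exact: integZ].
  rewrite normrN (le_trans (le_normr_Rintegral _ _))// -ExD//; apply: Ex_le => //.
  - by apply: integrable_norm.
  - exact: integD.
  - by move=> w; rewrite mulN1r; exact: err_le.
have ierrsum : integ (fun w => \sum_(k < K) err1 k w) by apply: (integ_sum (f := err1)).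
have [idm Edm] := dom_L1 K.
have sum1 : \sum_(k < K) Ex (err1 k) <= dl * expR (c + 1) * B.
  rewrite -(Ex_sum (f := err1))//.
  have iB : integ (fun w => dl * expR (c + 1) * (c * dom rate h K (walk w) + (quad_coef + lin_coef))).
    by apply: integZ; apply: integD; [exact: integZ|exact: integ_cst].
  apply: (@le_trans _ _ (Ex (fun w => dl * expR (c + 1) * (c * dom rate h K (walk w) + (quad_coef + lin_coef))))).
    apply: Ex_le => // w; rewrite /err1 -mulr_sumr; apply: ler_wpM2l.
      by rewrite mulr_ge0 ?expR_ge0// ltW.
    rewrite big_split/= -!mulr_sumr; apply: lerD.
      by apply: ler_wpM2l; [exact: ltW|exact: disc_dom].
    by rewrite ler_piMr ?sum_crossing_le1// addr_ge0// ltW.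
  rewrite ExZ; last by apply: integD; [exact: integZ|exact: integ_cst].
  apply: ler_wpM2l; first by rewrite mulr_ge0 ?expR_ge0// ltW.
  rewrite ExD ?Ex_cst; [|exact: integZ|exact: integ_cst].
  by rewrite lerD2r ExZ// ler_wpM2l// ltW.
have sum2 : \sum_(k < K) Ex (err2 k) <= K%:R * (kappa * (B * (2 * Cb))).
  rewrite (_ : K%:R * _ = \sum_(k < K) (kappa * (B * (2 * Cb)))); last first.
    by rewrite sumr_const card_ord mulr_natl.
  by apply: ler_sum => k _; exact: (err2_int k).2.
rewrite (phi_telescope K) dE.
rewrite (_ : _ - _ = - Ex (fun w => alive (walk w) K * phi K w) + \sum_(k < K) (Ex (t2 k) - Ex (t1 k))); last first.
  by rewrite sumrB; ring.
apply: (le_trans (ler_normD _ _)); apply: lerD; first by rewrite normrN ger0_norm.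
apply: (le_trans (ler_norm_sum _ _ _)).
apply: (@le_trans _ _ (\sum_(k < K) (Ex (err1 k) + Ex (err2 k)))); first by apply: ler_sum => k _; exact: bnd.
rewrite big_split/=.
rewrite (_ : B * _ = dl * expR (c + 1) * B + K%:R * (kappa * (B * (2 * Cb)))); last by ring.
exact: lerD.
Qed.

End error.

(** The discount factor makes this small: on survival [exp (- c * walk)] is at most 1, and the rest
    of [phi] has an expectation growing polynomially in the horizon, through [s <= 1 + s^2]. *)
Lemma Ex_phi_tail K : Ex (fun w => alive (walk w) K * phi K w) <=
  expR (- (rate * (K%:R * h))) * ((K%:R * h + (quad_coef + lin_coef)) * (1 + q * (1 + K%:R * h) ^+ 2)).
Proof.
have c2 := quad_coef_gt0; have c1 := lin_coef_gt0.
set t := K%:R * h; set Q := 1 + q * (1 + t) ^+ 2.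
have t0 : 0 <= t by rewrite mulr_ge0// ltW.
pose D w := h * \sum_(j < K) (1 + walk w j ^+ 2) + (quad_coef + lin_coef) * (1 + walk w K ^+ 2).
have i1 j : integ (fun w => 1 + walk w j ^+ 2).
  by apply: integD; [exact: integ_cst|exact: (walk2 j).1].
have E1 j : (j <= K)%N -> Ex (fun w => 1 + walk w j ^+ 2) <= Q.
  move=> jK; rewrite ExD ?Ex_cst; [|exact: integ_cst|exact: (walk2 j).1].
  rewrite lerD2l (le_trans (walk2 j).2)// ler_wpM2l// lerXn2r ?nnegrE ?addr_ge0 ?mulr_ge0 ?(ltW h0)//.
  by rewrite lerD2l ler_wpM2r ?(ltW h0)// ler_nat.
have isum : integ (fun w => \sum_(j < K) (1 + walk w j ^+ 2)).
  by apply: (integ_sum (f := fun j w => 1 + walk w j ^+ 2)).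
have iD : integ D by apply: integD; exact: integZ.
have [ip _ _] := phi_alive_step K.
apply: (@le_trans _ _ (Ex (fun w => expR (- (rate * t)) * D w))).
  apply: Ex_le => //; first exact: integZ.
  move=> w; rewrite /phi; have [->|[-> ak]] := alive_walk_ge0 w K.
    rewrite mul0r; apply: mulr_ge0; first exact: expR_ge0.
    apply: addr_ge0; apply: mulr_ge0; first exact: ltW.
    - by apply: sumr_ge0 => j _; rewrite addr_ge0// sqr_ge0.
    - by apply: addr_ge0; exact: ltW.
    - by rewrite addr_ge0// sqr_ge0.
  have s0 := ak K (leqnn K).
  have A0 : 0 <= area h (walk w) K by apply: area_ge0; [exact: ltW|move=> i /ltnW; exact: ak].
  rewrite mul1r; apply: ler_pM => //.
  - apply: addr_ge0; [apply: addr_ge0 => //|]; apply: mulr_ge0; rewrite ?sqr_ge0//; exact: ltW.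
  - by rewrite ler_expR gerBl mulr_ge0// ltW.
  rewrite /D [(quad_coef + lin_coef) * _]mulrDl addrA; apply: lerD; last first.
    by apply: ler_wpM2l; [exact: ltW|nra].
  apply: lerD; last by apply: ler_wpM2l; [exact: ltW|rewrite lerDr].
  rewrite /area; apply: ler_wpM2l; first exact: ltW.
  by apply: ler_sum => j _; nra.
rewrite ExZ//; apply: ler_wpM2l; first exact: expR_ge0.
rewrite /D ExD; [|exact: integZ|exact: integZ].
rewrite !ExZ// [leRHS]mulrDl; apply: lerD; last first.
  by apply: ler_wpM2l; [apply: addr_ge0; exact: ltW|exact: E1].
rewrite (Ex_sum (f := fun j w => 1 + walk w j ^+ 2))//.
apply: (@le_trans _ _ (h * \sum_(j < K) Q)).
  by apply: ler_wpM2l; [exact: ltW|apply: ler_sum => j _; exact/E1/ltnW].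
by rewrite sumr_const card_ord -mulr_natl /t mulrA (mulrC h).
Qed.

End walk.

(** * From grids to continuous paths *)

Section deterministic.
Context (R : realType).
Implicit Types (f g : R -> R).
Local Notation leb := (@lebesgue_measure R).

Definition primitive f (t : R) : R := (\int[leb]_(u in `[0%R, t]) f u)%R.

Lemma continuous_integrable_itv f (a b : R) : continuous f ->
  leb.-integrable `[a, b] (EFin \o f).
Proof.
move=> cf; apply: continuous_compact_integrable; first exact: segment_compact.
by apply: continuous_subspaceT.
Qed.

Lemma primitive_step f (a b v eta : R) : continuous f -> 0 <= a -> a <= b ->
  (forall t, a <= t <= b -> `|f t - v| <= eta) ->
  `|primitive f b - primitive f a - (b - a) * v| <= (b - a) * eta.
Proof.
move=> cf a0 ab hf.
have iab : leb.-integrable `]a, b] (EFin \o f).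
  apply: (@integrableS _ _ _ leb `[a, b]%classic) => //.
    by apply: subset_itvr; rewrite bnd_simp.
  exact: continuous_integrable_itv.
have icst r : leb.-integrable `]a, b] (EFin \o cst r).
  apply: (@integrableS _ _ _ leb `[a, b]%classic) => //.
    by apply: subset_itvr; rewrite bnd_simp.
  by apply: continuous_integrable_itv => t; exact: cvg_cst.
have lenE : fine (leb `]a, b]) = b - a.
  rewrite lebesgue_measure_itv/= lte_fin; case: ltP => //= ba.
  by rewrite (_ : a = b) ?subrr//; apply/eqP; rewrite eq_le ab ba.
rewrite /primitive (Rintegral_itvB (continuous_integrable_itv 0 b cf)) ?bnd_simp//.
have cstE r : (\int[leb]_(u in `]a, b]) r)%R = (b - a) * r.
  by rewrite Rintegral_cst// lenE mulrC.
rewrite -cstE -RintegralB//; last exact: icst.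
have ifv : leb.-integrable `]a, b] (EFin \o (fun t => f t - v)).
  by rewrite (_ : EFin \o _ = (EFin \o f) \- (EFin \o cst v))%E//; apply: integrableB => //; exact: icst.
apply: (le_trans (le_normr_Rintegral _ ifv)) => //.
rewrite -cstE; apply: le_Rintegral => //.
- by apply: integrable_norm.
- exact: icst.
- move=> t /=; rewrite in_itv/= => /andP[ta tb]; apply: hf; by rewrite ltW.
Qed.

Lemma primitive_area f (h eta : R) k : continuous f -> 0 < h ->
  (forall j t, (j < k)%N -> j%:R * h <= t <= j.+1%:R * h -> `|f t - f (j%:R * h)| <= eta) ->
  `|primitive f (k%:R * h) - area h (fun j => f (j%:R * h)) k| <= k%:R * h * eta.
Proof.
move=> cf h0; elim: k => [|k IH] hf.
  by rewrite /area big_ord0 !mul0r mulr0 subr0 /primitive set_itv1 Rintegral_set1 normr0.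
have {}IH := IH (fun j t jk => hf j t (ltnW jk)).
have kh0 : 0 <= k%:R * h by rewrite mulr_ge0// ltW.
have kh1 : k%:R * h <= k.+1%:R * h by rewrite ler_pM2r// ler_nat.
have hE : k.+1%:R * h - k%:R * h = h by rewrite -natr1; ring.
have := primitive_step cf kh0 kh1 (fun t => hf k t (ltnSn k)); rewrite hE => st.
rewrite /area big_ord_recr/= mulrDr -/(area h (fun j => f (j%:R * h)) k).
rewrite (_ : _ - _ = (primitive f (k%:R * h) - area h (fun j => f (j%:R * h)) k) +
  (primitive f (k.+1%:R * h) - primitive f (k%:R * h) - h * f (k%:R * h))); last by ring.
apply: (le_trans (ler_normD _ _)).
rewrite (_ : k.+1%:R * h * eta = k%:R * h * eta + h * eta); last by rewrite -natr1; ring.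
exact: lerD.
Qed.

(** Uniform continuity from compactness of [[0, M]]; only [t] is confined to the segment. *)
Lemma heine f (M eta : R) : continuous f -> 0 < eta ->
  exists2 dl : R, 0 < dl & forall s t, 0 <= t <= M -> `|s - t| <= dl -> `|f s - f t| <= eta.
Proof.
move=> cf eta0.
have /compact_near_coveringP nc := @segment_compact R 0 M.
have := nc R (0 : R)^'+ (fun dl t => forall s, `|s - t| <= dl -> `|f s - f t| <= eta) _.
have H : forall t, `[0, M]%classic t -> \forall t' \near t & dl \near (0:R)^'+,
   forall s, `|s - t'| <= dl -> `|f s - f t'| <= eta.
  move=> t _; have /cvgrPdist_lt/(_ (eta / 2)) := cf t.
  rewrite divr_gt0// => /(_ isT)[/= r r0 hr].
  have r20 : 0 < r / 2 by rewrite divr_gt0.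
  exists (ball t (r / 2), [set dl | dl < r / 2]) => /=.
    split; first exact: nbhsx_ballx.
    by apply: nbhs_right_lt.
  move=> [t' dl] /= [tt' dlr] s st'.
  have h1 : `|f t - f s| < eta / 2.
    apply: hr => /=; rewrite /ball/= in tt' *.
    rewrite (_ : t - s = (t - t') - (s - t')); last by ring.
    rewrite (le_lt_trans (ler_normB _ _))// [ltRHS](splitr r) ltr_leD//.
    by rewrite (le_trans st')// ltW.
  have h2 : `|f t - f t'| < eta / 2.
    by apply: hr => /=; rewrite /ball/= in tt' *; rewrite (lt_trans tt')//; lra.
  move: h1 h2 => /ltr_normlP[? ?] /ltr_normlP[? ?].
  by apply/ler_normlP; split; lra.
move=> /(_ _ H) hn.
have [/= r r0 hr] := hn; pose dl : R := r / 2.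
have dl0 : 0 < dl by rewrite divr_gt0.
have dl1 : `[0, M]%classic `<=` (fun t => forall s, `|s - t| <= dl -> `|f s - f t| <= eta).
  by apply: hr => //=; rewrite sub0r normrN gtr0_norm// /dl; lra.
by exists dl => // s t tM st; apply: dl1.
Qed.

Lemma disc_first lam h K (s : nat -> R) k : (k < K)%N -> s k.+1 < 0 ->
  (forall j, (j <= k)%N -> 0 <= s j) ->
  disc lam h K s = expR (- (lam * (k.+1%:R * h))) * area h s k.+1.
Proof.
move=> kK sk sj; rewrite /disc (bigD1 (Ordinal kK))//= big1 ?addr0; last first.
  move=> i /eqP ik; have [->|[_ si ai]] := crossing_bool i (sj 0%N (leq0n _)); first by rewrite mul0r.
  have [ki|] := ltnP k i; first by have := ai k.+1 ki; rewrite leNgt sk.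
  rewrite leq_eqVlt => /predU1P[ik'|ik']; first by case: ik; exact: val_inj.
  by have := sj i.+1 ik'; rewrite leNgt si.
rewrite (_ : crossing s k = 1) ?mul1r// /crossing sk mulr1.
have [a0|[]//] := alive_bool s k.
have : forall j, (j <= k)%N -> alive s j = 1.
  elim=> [|j IH] jk; first by rewrite alive0.
  by rewrite aliveS IH ?mul1r ?sj// ltnW.
by move=> /(_ k (leqnn k)); rewrite a0.
Qed.

(* The [n]-th grid has [n.+1 ^ 6] steps, so that it covers [[0, n.+1]]. *)
Definition grid_step (n : nat) : R := n.+1%:R ^- 5.

Lemma grid_step_gt0 n : 0 < grid_step n. Proof. by rewrite invr_gt0 exprn_gt0. Qed.

Lemma grid_step_le n : grid_step n <= n.+1%:R^-1.
Proof. by rewrite lef_pV2 ?posrE ?exprn_gt0// -[leLHS]expr1 ler_weXn2l// ler1n. Qed.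

Lemma near_grid_step (e : R) : 0 < e -> \forall n \near \oo, grid_step n < e.
Proof.
move=> e0; near=> n; rewrite (le_lt_trans (grid_step_le n))//.
rewrite invf_plt ?posrE// (@lt_le_trans _ _ n%:R) ?ler_nat//.
by near: n; exact: nbhs_infty_gtr.
Unshelve. all: by end_near. Qed.

Lemma grid_horizon n : (n.+1 ^ 6)%:R * grid_step n = n.+1%:R.
Proof. by rewrite natrX /grid_step; field. Qed.

(** The strict inequality makes the condition open for continuous [g], so that grid points close to
    a crossing satisfy it too. *)
Definition hitting_below g : R := inf [set t | 0 <= t /\ g t < 0].

Lemma primitive_cvg g (u : nat -> R) (s : R) : continuous g -> 0 <= s -> (forall n, 0 <= u n) ->
  u n @[n --> \oo] --> s -> primitive g (u n) @[n --> \oo] --> primitive g s.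
Proof.
move=> cg s0 u0 us; apply/cvgrPdist_le => e e0.
have /cvgrPdist_lt/(_ 1 ltr01)[/= r r0 hr] := cg s.
pose B := `|g s| + 1.
have B0 : 0 < B by rewrite ltr_wpDl.
have gB t : `|s - t| < r -> `|g t - 0| <= B.
  move=> /hr; rewrite subr0 /B => h.
  rewrite (_ : g t = g s - (g s - g t)); last by ring.
  by rewrite (le_trans (ler_normB _ _))// lerD2l ltW.
have eB : 0 < e / B by rewrite divr_gt0.
near=> n.
have h1 : `|s - u n| < r by near: n; move: us => /cvgrPdist_lt; apply.
have h2 : `|s - u n| <= e / B by near: n; move: us => /cvgrPdist_le; apply.
have [su|us'] := lerP s (u n).
  have := @primitive_step g s (u n) 0 B cg s0 su _; rewrite mulr0 subr0 distrC => h.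
  apply: (le_trans (h _)) => [t /andP[st tu]|].
    apply: gB; move: h1; rewrite distrC ger0_norm ?subr_ge0// => h1.
    by rewrite distrC ger0_norm ?subr_ge0//; lra.
  by rewrite -ler_pdivlMr//; move: h2; rewrite distrC ger0_norm ?subr_ge0.
have := @primitive_step g (u n) s 0 B cg (u0 n) (ltW us') _; rewrite mulr0 subr0 => h.
apply: (le_trans (h _)) => [t /andP[st tu]|].
  apply: gB; move: h1; rewrite ger0_norm ?subr_ge0 ?(ltW us')// => h1.
  by rewrite ger0_norm ?subr_ge0//; lra.
by rewrite -ler_pdivlMr//; move: h2; rewrite ger0_norm ?subr_ge0 ?(ltW us').
Unshelve. all: by end_near. Qed.

(** * Mesh limit along a fixed continuous path *)

Section stage1.
Variables (g : R -> R) (lam : R).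
Hypotheses (cg : continuous g) (g0 : 0 < g 0) (hit : exists2 t, 0 <= t & g t < 0).

Let sigma := hitting_below g.

Let has_inf_hit : has_inf [set t | 0 <= t /\ g t < 0].
Proof. by case: hit => t t0 gt; split; [exists t|exists 0 => s []]. Qed.

Let sigma_ge0 : 0 <= sigma.
Proof. by apply: lb_le_inf; [case: has_inf_hit|move=> s []]. Qed.

Let sigma_le t : 0 <= t -> g t < 0 -> sigma <= t.
Proof. by move=> t0 gt; apply: ge_inf => //; case: has_inf_hit. Qed.

Let first_idx n k := g (k.+1%:R * grid_step n) < 0 /\
  forall j, (j <= k)%N -> 0 <= g (j%:R * grid_step n).

(** Just after [sigma] there is a [t] with [g t < 0], and [g] stays negative within some [r] of [t].
    Once the mesh is below [r], the next grid point after [t] is negative too, so the first negative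
    grid point lies between [sigma] and that point. *)
Let first_exists (eta : R) : 0 < eta -> \forall n \near \oo, exists k,
  [/\ first_idx n k, (k < n.+1 ^ 6)%N & `|k.+1%:R * grid_step n - sigma| <= eta].
Proof.
move=> eta0.
have [t [t0 gt] tlt] : exists2 t, 0 <= t /\ g t < 0 & t < sigma + eta / 2.
  by apply: inf_adherent => //; rewrite divr_gt0.
have /cvgrPdist_lt/(_ (- g t)) := @cg t.
rewrite oppr_gt0 => /(_ gt)[/= r r0 hr].
near=> n.
have hn0 := grid_step_gt0 n.
have hr1 : grid_step n < r by near: n; exact: near_grid_step.
have he1 : grid_step n < eta / 2 by near: n; apply: near_grid_step; rewrite divr_gt0.
have tn : t + eta / 2 <= n.+1%:R.
  rewrite (@le_trans _ _ n%:R) ?ler_nat//; near: n; exact: nbhs_infty_ger.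
pose k := Num.truncn (t / grid_step n).
have th0 : 0 <= t / grid_step n by rewrite divr_ge0// ltW.
have /andP[k1 k2] := truncn_itv th0; rewrite -/k in k1 k2.
have kt : k%:R * grid_step n <= t by rewrite -ler_pdivlMr.
have tk : t < k.+1%:R * grid_step n by rewrite -ltr_pdivrMr.
have kE : k.+1%:R * grid_step n = k%:R * grid_step n + grid_step n by rewrite -natr1; ring.
have gk : g (k.+1%:R * grid_step n) < 0.
  have : `|g t - g (k.+1%:R * grid_step n)| < - g t.
    by apply: hr => /=; apply/ltr_normlP; split; lra.
  by move=> /ltr_normlP[? ?]; lra.
have ex : exists k, g (k.+1%:R * grid_step n) < 0 by exists k.
pose m := ex_minn ex.
have [m1 m2] : g (m.+1%:R * grid_step n) < 0 /\ forall j, g (j.+1%:R * grid_step n) < 0 -> (m <= j)%N.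
  by rewrite /m; case: ex_minnP.
have mk : (m <= k)%N by exact: m2.
exists m; split.
- split=> //; case=> [_|j jm]; first by rewrite mul0r ltW.
  by rewrite leNgt; apply/negP => /m2; rewrite leqNgt jm.
- have : m.+1%:R * grid_step n <= (n.+1 ^ 6)%:R * grid_step n.
    rewrite grid_horizon (@le_trans _ _ (k.+1%:R * grid_step n)) ?ler_pM2r ?ler_nat//.
    by rewrite (le_trans _ tn)// kE; lra.
  by rewrite ler_pM2r// ler_nat.
- have s1 : sigma <= m.+1%:R * grid_step n by apply: sigma_le => //; rewrite mulr_ge0// ltW.
  have s2 : m.+1%:R * grid_step n <= k.+1%:R * grid_step n by rewrite ler_pM2r// ler_nat.
  by apply/ler_normlP; split; lra.
Unshelve. all: by end_near. Qed.

Lemma cvg_disc :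
  disc lam (grid_step n) (n.+1 ^ 6) (fun k => g (k%:R * grid_step n)) @[n --> \oo] -->
  expR (- (lam * sigma)) * primitive g sigma.
Proof.
(* The default [0] can occur for finitely many [n] only, by [first_exists]. *)
pose kap n := xget 0%N [set k | first_idx n k].
pose u n := (kap n).+1%:R * grid_step n.
have u0 n : 0 <= u n by rewrite mulr_ge0// ltW// grid_step_gt0.
have uniq n k k' : first_idx n k -> first_idx n k' -> k = k'.
  move=> [a1 a2] [b1 b2]; apply/eqP; rewrite eqn_leq; apply/andP; split; rewrite leqNgt; apply/negP => h.
    by have := a2 _ h; rewrite leNgt b1.
  by have := b2 _ h; rewrite leNgt a1.
have near_kap eta : 0 < eta -> \forall n \near \oo, [/\ first_idx n (kap n), (kap n < n.+1 ^ 6)%N & `|u n - sigma| <= eta].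
  move=> eta0; apply: filterS (first_exists eta0) => n [k [fk kn ke]].
  have fkap : first_idx n (kap n) by rewrite /kap; case: xgetP => [y -> //|/(_ k)].
  by rewrite /u (uniq _ _ _ fkap fk).
have us : u n @[n --> \oo] --> sigma.
  apply/cvgrPdist_le => e e0; apply: filterS (near_kap e e0) => n [_ _].
  by rewrite distrC.
pose ar n := area (grid_step n) (fun k => g (k%:R * grid_step n)) (kap n).+1.
have ars : ar n @[n --> \oo] --> primitive g sigma.
  apply/cvgrPdist_le => e e0.
  have s1 : 0 < sigma + 1 by rewrite ltr_wpDl.
  have e2 : 0 < e / 2 / (sigma + 1) by rewrite !divr_gt0.
  have [dl dl0 hdl] := heine (sigma + 1) cg e2.
  near=> n.
  have hn0 := grid_step_gt0 n.
  have [_ _ un] : [/\ first_idx n (kap n), (kap n < n.+1 ^ 6)%N & `|u n - sigma| <= 1].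
    by near: n; exact: near_kap.
  have hd : grid_step n <= dl by apply: ltW; near: n; exact: near_grid_step.
  have h1 : `|primitive g sigma - primitive g (u n)| <= e / 2.
    by near: n; have /cvgrPdist_le := primitive_cvg cg sigma_ge0 u0 us; apply; rewrite divr_gt0.
  have uns : u n <= sigma + 1 by move: un => /ler_normlP[? ?]; lra.
  have := @primitive_area g (grid_step n) (e / 2 / (sigma + 1)) (kap n).+1 cg hn0.
  rewrite -/(u n) -/(ar n) => h2.
  have {}h2 : `|primitive g (u n) - ar n| <= e / 2.
    apply: (le_trans (h2 _)) => [j t jk /andP[t1 t2]|].
      have jE : j.+1%:R * grid_step n = j%:R * grid_step n + grid_step n by rewrite -natr1; ring.
      apply: hdl.
        rewrite mulr_ge0 ?(ltW hn0)//= (le_trans _ uns)// /u ler_pM2r// ler_nat; exact: ltnW.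
      by apply/ler_normlP; split; lra.
    rewrite mulrC (le_trans (ler_wpM2l (ltW e2) uns))//.
    by rewrite divfK// gt_eqF.
  move: h1 h2 => /ler_normlP[? ?] /ler_normlP[? ?].
  by apply/ler_normlP; split; lra.
have eq : \forall n \near \oo, expR (- (lam * u n)) * ar n =
   disc lam (grid_step n) (n.+1 ^ 6) (fun k => g (k%:R * grid_step n)).
  apply: filterS (near_kap 1 ltr01) => n [[f1 f2] kn _].
  by rewrite (disc_first _ _ kn).
apply: cvg_trans (near_eq_cvg eq) _.
apply: cvgM => //; apply: continuous_cvg; first exact: continuous_expR.
by apply: cvgN; apply: cvgM => //; exact: cvg_cst.
Unshelve. all: by end_near. Qed.

End stage1.

(** * Level limit along a fixed continuous path *)

Section stage2.
Variables (f : R -> R) (lam x : R).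
Hypotheses (cf : continuous f) (f0 : f 0 = x) (x0 : 0 < x) (hit : exists2 t, 0 <= t & f t < 0).

(** The denominator starts at 2, so every level is strictly below the starting point. *)
Definition level (m : nat) : R := x / m.+2%:R.

Lemma level_gt0 m : 0 < level m. Proof. by rewrite divr_gt0. Qed.
Lemma level_ltx m : level m < x.
Proof. by rewrite ltr_pdivrMr// ltr_pMr// ltr1n. Qed.

Lemma cvg_level : level m @[m --> \oo] --> (0 : R).
Proof.
apply/cvgrPdist_le => e e0; near=> m.
rewrite sub0r normrN ger0_norm ?(ltW (level_gt0 m))// ler_pdivrMr// mulrC -ler_pdivrMr//.
rewrite (@le_trans _ _ m%:R) ?ler_nat//; last by rewrite (leq_trans (leqnSn m)).
by near: m; exact: nbhs_infty_ger.
Unshelve. all: by end_near. Qed.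

Let tau := inf [set t | 0 < t /\ f t <= 0].

Let has_inf_tau : has_inf [set t | 0 < t /\ f t <= 0].
Proof.
case: hit => t t0 gt; split; last by exists 0 => s [/ltW].
exists t; split; last exact: ltW.
rewrite lt_neqAle t0 andbT; apply/eqP => t00; move: gt; rewrite -t00 f0.
by rewrite ltNge (ltW x0).
Qed.

Let tau_lt t : 0 <= t -> t < tau -> 0 < f t.
Proof.
rewrite le_eqVlt => /predU1P[<- _|t0 tt]; first by rewrite f0.
rewrite ltNge; apply/negP => ft; have : tau <= t by apply: ge_inf => //; case: has_inf_tau.
by rewrite leNgt tt.
Qed.

Lemma first_passage_gt0 : 0 < tau.
Proof.
have /cvgrPdist_lt/(_ x x0)[/= r r0 hr] := @cf 0.
apply: (lt_le_trans r0); apply: lb_le_inf; first by case: has_inf_tau.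
move=> s [s0 fs]; rewrite leNgt; apply/negP => sr.
have : `|f 0 - f s| < x by apply: hr; rewrite /= sub0r normrN ger0_norm// ltW.
by rewrite f0 => /ltr_normlP[? ?]; lra.
Qed.

Let sig m := hitting_below (fun t => f t - level m).

Let hit_m m : exists2 t, 0 <= t & f t - level m < 0.
Proof. by case: hit => t t0 gt; exists t => //; have := level_gt0 m; lra. Qed.

Let has_inf_m m : has_inf [set t | 0 <= t /\ f t - level m < 0].
Proof. by case: (hit_m m) => t t0 gt; split; [exists t|exists 0 => s []]. Qed.

Let sig_ge0 m : 0 <= sig m.
Proof. by apply: lb_le_inf; [case: (has_inf_m m)|move=> s []]. Qed.

(** At points where [f <= 0] the path is below every level, which bounds [sig m] above. On
    [[0, tau - eta]] the path has a positive minimum, and once the level is below it no crossing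
    occurs there. *)
Let sig_cvg : sig m @[m --> \oo] --> tau.
Proof.
apply/cvgrPdist_le => eta eta0.
have up m : sig m <= tau + eta.
  have [t [t0 ft] tlt] : exists2 t, 0 < t /\ f t <= 0 & t < tau + eta by apply: inf_adherent.
  rewrite (le_trans _ (ltW tlt))//; apply: ge_inf; first by case: (has_inf_m m).
  by split; [exact: ltW|have := level_gt0 m; lra].
suff low : \forall m \near \oo, tau - eta <= sig m.
  apply: filterS low => m low; have := up m => u.
  by apply/ler_normlP; split; lra.
have [te|te] := ltrP (tau - eta) 0.
  by near=> m; rewrite (le_trans (ltW te)).
have [c cin cmin] := @EVT_min R f 0 (tau - eta) te (continuous_subspaceT cf).
move: cin; rewrite in_itv/= => /andP[c0 c1].
have fc : 0 < f c by apply: tau_lt => //; lra.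
near=> m.
have lm : level m <= f c.
  near: m; have /cvgrPdist_le/(_ _ fc) := cvg_level; apply: filterS => m.
  by rewrite sub0r normrN ger0_norm// ltW// level_gt0.
apply: lb_le_inf; first by case: (has_inf_m m).
move=> s [s0 fs]; rewrite leNgt; apply/negP => st.
have : f c <= f s by apply: cmin; rewrite in_itv/= s0 ltW.
by lra.
Unshelve. all: by end_near. Qed.

Lemma primitive_sub (e t : R) : 0 <= t -> primitive (fun t => f t - e) t = primitive f t - e * t.
Proof.
move=> t0; rewrite /primitive RintegralB//.
- rewrite Rintegral_cst//= lebesgue_measure_itv/= lte_fin; case: ltP => //=; first by rewrite subr0.
  by move=> t0'; rewrite (_ : t = 0)//; apply/eqP; rewrite eq_le t0 t0'.
- exact: continuous_integrable_itv.
- by apply: continuous_integrable_itv => u; exact: cvg_cst.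
Qed.

Lemma cvg_levels :
  expR (- (lam * sig m)) * primitive (fun t => f t - level m) (sig m) @[m --> \oo] -->
  expR (- (lam * tau)) * primitive f tau.
Proof.
apply: cvgM.
  apply: continuous_cvg; first exact: continuous_expR.
  by apply: cvgN; apply: cvgM => //; exact: cvg_cst.
rewrite (_ : (fun m => _) = (fun m => primitive f (sig m) - level m * sig m)); last first.
  by apply/funext => m; rewrite primitive_sub.
rewrite -[X in _ --> X]subr0 -(mul0r tau); apply: cvgB.
  exact: (primitive_cvg cf (ltW first_passage_gt0) sig_ge0 sig_cvg).
by apply: cvgM => //; exact: cvg_level.
Qed.

End stage2.

End deterministic.

Arguments grid_step {R} n.

(** * Brownian motion on a grid *)

(** The bound [exp (- y) <= 4! / y^4] against a cubic polynomial leaves [1 / N]. *)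
Lemma expR_poly_tail_le (R : realType) (l N a q : R) : 0 < l -> 1 <= N -> 0 <= a -> 0 <= q ->
  expR (- (l * N)) * ((N + a) * (1 + q * (1 + N) ^+ 2)) <=
  ((1 + a) * (1 + 4 * q) * (24 / l ^+ 4)) / N.
Proof.
move=> l0 N1 a0 q0; have N0 : 0 < N by rewrite (lt_le_trans _ N1).
have l4 : 0 < l ^+ 4 by rewrite exprn_gt0.
have N4 : 0 < N ^+ 4 by rewrite exprn_gt0.
have e4 : expR (- (l * N)) <= 24 / (l ^+ 4 * N ^+ 4).
  have := le_fact_expR 4 (l * N); rewrite ger0_norm; last by rewrite mulr_ge0// ltW.
  rewrite exprMn => h; rewrite expRN -[leLHS]mul1r ler_pdivrMr ?expR_gt0//.
  by rewrite mulrAC ler_pdivlMr ?mul1r ?mulr_gt0.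
have na : N + a <= (1 + a) * N by nra.
have qa : 1 + q * (1 + N) ^+ 2 <= (1 + 4 * q) * N ^+ 2.
  have : 1 <= N ^+ 2 by rewrite exprn_ege1.
  have : (1 + N) ^+ 2 <= 4 * N ^+ 2 by nra.
  by move=> h1 h2; have := ler_wpM2l q0 h1; lra.
have q1 : 0 <= 1 + q * (1 + N) ^+ 2 by rewrite addr_ge0// mulr_ge0// sqr_ge0.
have Na : 0 <= N + a by rewrite addr_ge0// ltW.
have -> : ((1 + a) * (1 + 4 * q) * (24 / l ^+ 4)) / N =
   24 / (l ^+ 4 * N ^+ 4) * (((1 + a) * N) * ((1 + 4 * q) * N ^+ 2)).
  by field; rewrite !gt_eqF.
by apply: ler_pM => //; [exact: mulr_ge0|exact: ler_pM].
Qed.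

Lemma drift_sqr_le (R : realType) (x e mu t : R) : 0 < x -> 0 <= e -> e < x -> 0 < mu -> 0 <= t ->
  (x - e - mu * t) ^+ 2 + t <= (x + mu + 1) ^+ 2 * (1 + t) ^+ 2.
Proof.
move=> x0 e0 ex mu0 t0; have mt0 : 0 <= mu * t by rewrite mulr_ge0// ltW.
have a1 : (x - e - mu * t) ^+ 2 <= (x + mu * t) ^+ 2.
  rewrite -subr_ge0 subr_sqr mulr_ge0//; lra.
apply: (le_trans (lerD a1 (lexx t))).
have a2 : x + mu * t + 1 + t <= (x + mu + 1) * (1 + t).
  by have := mulr_ge0 (ltW x0) t0; lra.
apply: (@le_trans _ _ ((x + mu * t + 1 + t) ^+ 2)); last first.
  have b0 : 0 <= x + mu * t + 1 + t by lra.
  by rewrite -exprMn lerXn2r ?nnegrE// (le_trans b0 a2).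
by nra.
Qed.

Section brownian.
Context (R : realType) d (T : measurableType d).
Variables (P : probability T R) (B : R -> {RV P >-> R}).
Hypothesis hB : standard_brownian_motion B.
Variables (x mu : R).
Hypotheses (hx : 0 < x) (hmu : 0 < mu).
Local Notation Ex f := (\int[P]_x f x)%R.
Local Notation integ f := (P.-integrable setT (EFin \o f)).

(* [B 0] vanishes only almost surely; subtracting it makes the path start at [x] everywhere. *)
Definition bpath (w : T) (t : R) : R := x - mu * t + (B t w - B 0 w).

Lemma measurable_bpath t : measurable_fun setT (bpath ^~ t).
Proof. by apply: measurable_funD => //; exact: measurable_funB. Qed.

Lemma bpath_second_moment (e t : R) : 0 <= t ->
  integ (fun w => (bpath w t - e) ^+ 2) /\
  Ex (fun w => (bpath w t - e) ^+ 2) = (x - e - mu * t) ^+ 2 + t.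
Proof.
rewrite le_eqVlt => /predU1P[<-|t0].
  have pe w : (bpath w 0 - e) ^+ 2 = (x - e) ^+ 2 by rewrite /bpath; congr (_ ^+ 2); ring.
  rewrite (_ : (fun w => _) = cst ((x - e) ^+ 2)); last by apply/funext => w; rewrite pe.
  by split; [exact: integ_cst|rewrite Ex_cst mulr0 subr0 addr0].
pose Z := B t \- B 0.
have mZ : measurable_fun setT Z by exact: measurable_funB.
have lawZ A : measurable A -> pushforward P Z A = normal_prob 0 (Num.sqrt t) A.
  by move=> mA; rewrite (bm_normal_increments hB (lexx 0) t0 mA) subr0.
set m := x - e - mu * t.
have e0 z : expR (0 * z) = 1 :> R by rewrite mul0r expR0.
have i1 : integ Z.
  have := normal_integ_polyexp mZ t0 lawZ 1 0.
  by rewrite (_ : (fun w => _) = Z)//; apply/funext => w; rewrite e0 mulr1.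
have i2 : integ (fun w => Z w ^+ 2).
  have := normal_integ_polyexp mZ t0 lawZ 2 0.
  by rewrite (_ : (fun w => _) = (fun w => Z w ^+ 2))//; apply/funext => w; rewrite e0 mulr1.
have E1 : Ex Z = 0.
  have := normal_Ex_Zexp mZ t0 lawZ 0.
  by rewrite !mul0r => <-; apply: eq_Rintegral => w _; rewrite e0 mulr1.
have E2 : Ex (fun w => Z w ^+ 2) = t.
  have := normal_Ex_Z2exp mZ t0 lawZ 0.
  rewrite expr0n/= !mul0r addr0 expR0 mulr1 => <-.
  by apply: eq_Rintegral => w _; rewrite e0 mulr1.
have pE : (fun w => (bpath w t - e) ^+ 2) = (fun w => m ^+ 2 + 2 * m * Z w + Z w ^+ 2).
  by apply/funext => w; rewrite /bpath /m /Z/=; ring.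
have iz : integ (fun w => m ^+ 2 + 2 * m * Z w).
  by apply: integD; [exact: integ_cst|exact: integZ].
rewrite pE; split; first exact: integD.
rewrite ExD// ExD ?Ex_cst ?ExZ// ?E1 ?E2 ?mulr0 ?addr0//; [exact: integ_cst|exact: integZ].
Qed.

Section grid.
Variables (h e : R).
Hypotheses (h0 : 0 < h) (h1 : h <= 1) (e0 : 0 <= e) (ex : e < x).

Definition incr (i : nat) : T -> R := B (i.+1%:R * h) \- B (i%:R * h).

Lemma measurable_incr i : measurable_fun setT (incr i).
Proof. exact: measurable_funB. Qed.

Lemma incr_indep n (A : nat -> set R) : (forall i, measurable (A i)) ->
  P (\bigcap_(i in `I_n) incr i @^-1` A i) = (\prod_(i < n) P (incr i @^-1` A i))%E.
Proof.
move=> mA; have nd : nondecreasing_seq (fun i : nat => i%:R * h).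
  by move=> i j ij; rewrite ler_wpM2r ?(ltW h0)// ler_nat.
have t0 : 0 <= 0%N%:R * h by rewrite mul0r.
have ind : mutually_independent P (fun i : 'I_n => incr i : T -> R).
  exact: (bm_indep_increments hB t0 nd).
have := ind (fun i : 'I_n => A i) (fun i => mA i); move=> <-; congr (P _).
apply/seteqP; split=> w hw i /=; first by move=> _; exact: (hw i (ltn_ord i)).
by move=> ni; exact: (hw (Ordinal ni)).
Qed.

Lemma incr_law i A : measurable A -> pushforward P (incr i) A = normal_prob 0 (Num.sqrt h) A.
Proof.
move=> mA; have hE : i.+1%:R * h - i%:R * h = h by rewrite -natr1; ring.
have s0 : 0 <= i%:R * h by rewrite mulr_ge0// ltW.
have st : i%:R * h < i.+1%:R * h by rewrite ltr_pM2r// ltr_nat.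
by have := bm_normal_increments hB s0 st mA; rewrite hE.
Qed.

Lemma walk_bpath w : walk mu h (x - e) incr w = (fun k => bpath w (k%:R * h) - e).
Proof.
apply/funext; elim => [|k IH].
  by rewrite walk0 /bpath mul0r; ring.
by rewrite walkS IH /bpath /incr/= -natr1; ring.
Qed.

(** Depends neither on the mesh nor on the level, so [dom2_bound] serves for both limits. *)
Definition grid_q : R := (x + mu + 1) ^+ 2.

Lemma walk_bpath2 k : integ (fun w => walk mu h (x - e) incr w k ^+ 2) /\
  Ex (fun w => walk mu h (x - e) incr w k ^+ 2) <= grid_q * (1 + k%:R * h) ^+ 2.
Proof.
have t0 : 0 <= k%:R * h by rewrite mulr_ge0// ltW.
have [i E] := bpath_second_moment e t0.
have wE : (fun w => walk mu h (x - e) incr w k ^+ 2) = (fun w => (bpath w (k%:R * h) - e) ^+ 2).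
  by apply/funext => w; rewrite walk_bpath.
by rewrite wE E; split=> //; exact: drift_sqr_le.
Qed.

Variable c : R.
Hypothesis c0 : 0 < c.

Lemma grid_disc_measurable K :
  measurable_fun setT (fun w => disc (rate mu c) h K (fun k => bpath w (k%:R * h) - e)).
Proof.
have := disc_measurable measurable_incr walk_bpath2 c K.
by rewrite (_ : (fun w => _) = (fun w => disc (rate mu c) h K (fun k => bpath w (k%:R * h) - e)))//;
  apply/funext => w; rewrite walk_bpath.
Qed.

Lemma grid_disc_ge0 K w : 0 <= disc (rate mu c) h K (fun k => bpath w (k%:R * h) - e).
Proof.
rewrite disc_ge0 ?(ltW h0)// mul0r /bpath subrr mulr0 subr0 addr0 subr_ge0 ltW//.
Qed.

Lemma grid_disc_L2 K :
  integ (fun w => disc (rate mu c) h K (fun k => bpath w (k%:R * h) - e) ^+ 2) /\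
  Ex (fun w => disc (rate mu c) h K (fun k => bpath w (k%:R * h) - e) ^+ 2) <=
  dom2_bound mu grid_q c.
Proof.
have xe0 : 0 < x - e by rewrite subr_gt0.
have := disc_L2 hmu h0 h1 xe0 (sqr_ge0 _) measurable_incr walk_bpath2 c0 K.
rewrite (_ : (fun w => disc _ _ _ (walk _ _ _ _ w) ^+ 2) = (fun w => disc (rate mu c) h K (fun k => bpath w (k%:R * h) - e) ^+ 2))//.
by apply/funext => w; rewrite walk_bpath.
Qed.

Lemma grid_disc_error (dl : R) K : 0 < dl -> dl <= 1 ->
  `|Ex (fun w => disc (rate mu c) h K (fun k => bpath w (k%:R * h) - e)) -
    expR (- (c * (x - e))) * (quad_coef mu c * (x - e) ^+ 2 + lin_coef mu h c * (x - e))| <=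
  expR (- (rate mu c * (K%:R * h))) *
     ((K%:R * h + (quad_coef mu c + lin_coef mu h c)) * (1 + grid_q * (1 + K%:R * h) ^+ 2)) +
  (c * (1 + dom2_bound mu grid_q c) + (quad_coef mu c + lin_coef mu h c)) *
    (dl * expR (c + 1) + K%:R *
        (24 * h ^+ 2 / dl ^+ 3 * (2 * expR ((c + 2) ^+ 2 / 2 + (c + 2) * mu)))).
Proof.
move=> dl0 dl1; have xe0 : 0 < x - e by rewrite subr_gt0.
have e1 := Ex_disc_error hmu h0 h1 xe0 (sqr_ge0 _) measurable_incr incr_indep incr_law walk_bpath2 c0 dl0 dl1 K.
have e2 := Ex_phi_tail hmu h0 xe0 (sqr_ge0 _) measurable_incr incr_indep incr_law walk_bpath2 c0 K.
rewrite (_ : (fun w => disc _ _ _ (fun k => _)) = (fun w => disc (rate mu c) h K (walk mu h (x - e) incr w))); last first.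
  by apply/funext => w; rewrite walk_bpath.
by apply: (le_trans e1); rewrite lerD2r.
Qed.
End grid.

(** The starting value of the discrete martingale at zero mesh, where the correction [h / 2] has
    disappeared. *)
Definition limit_value (c y : R) : R :=
  expR (- (c * y)) * (y ^+ 2 / (2 * (c + mu)) + y / (2 * (c + mu) ^+ 2)).

Lemma grid_step_le1 n : grid_step n <= 1 :> R.
Proof. by rewrite invf_le1 ?exprn_gt0// exprn_ege1// ler1n. Qed.

Definition grid_disc (c e : R) (n : nat) (w : T) : R :=
  disc (rate mu c) (grid_step n) (n.+1 ^ 6) (fun k => bpath w (k%:R * grid_step n) - e).

Lemma cvg_Ex_grid_disc (c e : R) : 0 < c -> 0 <= e -> e < x ->
  Ex (grid_disc c e n) @[n --> \oo] --> limit_value c (x - e).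
Proof.
move=> c0 e0 ex.
set y := x - e; have y0 : 0 < y by rewrite subr_gt0.
have r0 : 0 < rate mu c by exact: rate_gt0.
have q0 : 0 <= grid_q by exact: sqr_ge0.
(* The value at mesh 1 dominates [lin_coef] for every mesh used. *)
pose b1 := lin_coef mu 1 c; pose a1 := quad_coef mu c.
have a10 : 0 < a1 by exact: quad_coef_gt0.
have b10 : 0 < b1 by exact: lin_coef_gt0.
have M0 : 0 <= dom2_bound mu grid_q c by exact: dom2_bound_ge0.
pose Q := c * (1 + dom2_bound mu grid_q c) + (a1 + b1).
have Q0 : 0 <= Q.
  apply: addr_ge0; last by apply: addr_ge0; exact: ltW.
  by apply: mulr_ge0; [exact: ltW|exact: addr_ge0].
pose C1 := (1 + (a1 + b1)) * (1 + 4 * grid_q) * (24 / rate mu c ^+ 4).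
pose C2 := expR (c + 1) + 48 * expR ((c + 2) ^+ 2 / 2 + (c + 2) * mu).
pose C := C1 + Q * C2 + y.
have C20 : 0 <= C2 by rewrite addr_ge0 ?mulr_ge0 ?expR_ge0.
(* With mesh [N^-5], [N^6] steps and [dl = 1 / N], each error is of order [1 / N]: the tail through
   [C1], the overshoot through [Q * C2], and the correction [h / 2] through [y]. *)
have bound n : `|Ex (grid_disc c e n) - limit_value c y| <= C / n.+1%:R.
  set N : R := n.+1%:R.
  have N1 : 1 <= N by rewrite ler1n.
  have N0 : 0 < N by rewrite (lt_le_trans _ N1).
  have Nn0 : N != 0 by rewrite gt_eqF.
  have dl0 : 0 < N^-1 by rewrite invr_gt0.
  have dl1 : N^-1 <= 1 by rewrite invf_le1.
  have hE : grid_step n = N ^- 5 by [].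
  have := @grid_disc_error (grid_step n) e (grid_step_gt0 R n) (grid_step_le1 n) e0 ex c c0 N^-1 (n.+1 ^ 6) dl0 dl1.
  have KE : (n.+1 ^ 6)%:R = N ^+ 6 :> R by rewrite natrX.
  have KhE : (n.+1 ^ 6)%:R * grid_step n = N by rewrite KE hE; field.
  have b1h : lin_coef mu (grid_step n) c <= b1 by rewrite /b1 /lin_coef lerD2l ler_wpM2r// grid_step_le1.
  have bh0 : 0 < lin_coef mu (grid_step n) c by apply: lin_coef_gt0 => //; exact: grid_step_gt0.
  rewrite KhE -/a1 -/y => err.
  have t1 : expR (- (rate mu c * N)) * ((N + (a1 + lin_coef mu (grid_step n) c)) * (1 + grid_q * (1 + N) ^+ 2)) <= C1 / N.
    have := expR_poly_tail_le r0 N1 (addr_ge0 (ltW a10) (ltW b10)) q0.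
    apply: le_trans; apply: ler_wpM2l; first exact: expR_ge0.
    apply: ler_wpM2r; first by rewrite addr_ge0// mulr_ge0// sqr_ge0.
    by apply: lerD => //; exact: lerD.
  have t2 : (c * (1 + dom2_bound mu grid_q c) + (a1 + lin_coef mu (grid_step n) c)) *
    (N^-1 * expR (c + 1) + (n.+1 ^ 6)%:R *
        (24 * grid_step n ^+ 2 / N^-1 ^+ 3 * (2 * expR ((c + 2) ^+ 2 / 2 + (c + 2) * mu)))) <= Q * C2 / N.
    rewrite KE hE (_ : _ + N ^+ 6 * _ = C2 / N); last by rewrite /C2; field.
    rewrite -[leRHS]mulrA; apply: ler_wpM2r; first by rewrite divr_ge0// ltW.
    by rewrite /Q; apply: lerD => //; exact: lerD.
  have t3 : `|expR (- (c * y)) * (a1 * y ^+ 2 + lin_coef mu (grid_step n) c * y) - limit_value c y| <= y / N.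
    rewrite /limit_value -mulrBr (_ : _ - _ = grid_step n / 2 * y); last first.
      by rewrite /a1 /quad_coef /lin_coef; field; rewrite gt_eqF// addr_gt0.
    rewrite ger0_norm; last by rewrite !mulr_ge0 ?expR_ge0 ?(ltW (grid_step_gt0 R n)) ?(ltW y0).
    have hN : grid_step n <= N^-1.
      rewrite hE lef_pV2 ?posrE ?exprn_gt0// -[leLHS]expr1.
      by apply: ler_weXn2l.
    have ey : expR (- (c * y)) <= 1 by rewrite -[leRHS]expR0 ler_expR oppr_le0 mulr_ge0// ltW.
    rewrite -[leRHS]mul1r; apply: ler_pM => //; first by rewrite !mulr_ge0 ?(ltW (grid_step_gt0 R n)) ?(ltW y0).
    rewrite [leRHS]mulrC; apply: ler_wpM2r; first exact: ltW.
    by rewrite (le_trans _ hN)// ler_piMr ?(ltW (grid_step_gt0 R n))// invf_le1// ler1n.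
  rewrite (_ : _ - _ = (Ex (grid_disc c e n) - expR (- (c * y)) * (a1 * y ^+ 2 + lin_coef mu (grid_step n) c * y)) +
     (expR (- (c * y)) * (a1 * y ^+ 2 + lin_coef mu (grid_step n) c * y) - limit_value c y)); last by ring.
  apply: (le_trans (ler_normD _ _)); rewrite /C [leRHS]mulrDl; apply: lerD => //.
  by apply: (le_trans err); rewrite [leRHS]mulrDl; exact: lerD.
have C0 : 0 <= C.
  by have := bound 0%N; rewrite divr1; apply: le_trans.
apply/cvgrPdist_le => eps eps0.
near=> n; rewrite distrC (le_trans (bound n))// ler_pdivrMr// -ler_pdivrMl//.
rewrite (@le_trans _ _ n%:R) ?ler_nat//; near: n; exact: nbhs_infty_ger.
Unshelve. all: by end_near. Qed.

End brownian.

(** * Laplace transform in the rate and conclusion *)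

(** Freezing the path at its value at 0 for negative times gives a function continuous on the whole
    line, as the deterministic lemmas require. *)
Lemma continuous_max0 (R : realType) (f : R -> R) :
  {within `[0, +oo[, continuous f} -> continuous (fun t : R => f (Num.max t 0)).
Proof.
move=> /continuous_within_itvcyP[cf f0] t; rewrite /continuous_at.
have [t0|t0] := ltrP 0 t.
  have ct : f u @[u --> t] --> f t by apply: cf; rewrite in_itv/= t0.
  apply: cvg_trans ct; apply: near_eq_cvg.
  near=> u; rewrite max_l//; apply: ltW; near: u; exact: lt_nbhsr.
apply/cvgrPdist_lt => e e0.
move/cvgrPdist_lt : f0 => /(_ e e0)[/= r r0 hr].
have [u0|u0] := ltrP t 0.
  near=> u; rewrite max_r ?subrr ?normr0//; apply: ltW; near: u; exact: lt_nbhsl.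
have -> : t = 0 by apply/eqP; rewrite eq_le t0.
exists r => //= u; rewrite /ball/= sub0r normrN => ur.
have [u1|u1] := lerP u 0; first by rewrite subrr normr0.
by apply: hr => //=; rewrite sub0r normrN.
Unshelve. all: by end_near. Qed.

Lemma null_off_ae d (T : measurableType d) (R : realType) (P : probability T R) (Q : T -> Prop) :
  {ae P, forall w, Q w} -> exists N, [/\ measurable N, P N = 0%E & forall w, ~ N w -> Q w].
Proof.
move=> [N [mN N0 hN]]; exists N; split=> // w nw; apply: contrapT => nQ; apply: nw.
exact: hN.
Qed.

Lemma hit_arith (R : realType) (x mu n : R) : 0 < x -> 2 * x < mu * n ->
  0 < mu * n - x /\ mu * n / 2 <= mu * n - x.
Proof. by move=> x0 h; split; lra. Qed.

Lemma sqr_le_addl (R : realType) (u v : R) : 0 <= u -> 0 <= v -> v ^+ 2 <= (u + v) ^+ 2.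
Proof. by move=> u0 v0; rewrite ler_pXn2r ?nnegrE ?addr_ge0 ?lerDr. Qed.

(** * Almost sure regularity of the paths *)

Section brownian_paths.
Context (R : realType) d (T : measurableType d).
Variables (P : probability T R) (B : R -> {RV P >-> R}).
Hypothesis hB : standard_brownian_motion B.
Variables (x mu : R).
Hypotheses (hx : 0 < x) (hmu : 0 < mu).
Local Notation Ex f := (\int[P]_x f x)%R.
Local Notation integ f := (P.-integrable setT (EFin \o f)).
Local Notation bp := (bpath B x mu).

Let nonhit n := [set w | 0 <= bp w n%:R].

Let mnonhit n : measurable (nonhit n).
Proof.
rewrite (_ : nonhit n = (bp ^~ n%:R) @^-1` `[0, +oo[).
  rewrite -[X in measurable X]setTI; exact: measurable_bpath.
by apply/seteqP; split=> w /=; rewrite /nonhit/= in_itv/= andbT.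
Qed.

(** Chebyshev at a late integer time [n]: the mean is [x - mu n] and the variance [n], so being
    nonnegative requires a deviation of at least [mu n / 2], of probability at most
    [4 / (mu^2 n)]. *)
Lemma hit_null : P (\bigcap_n nonhit n) = 0%E.
Proof.
have mI : measurable (\bigcap_n nonhit n) by exact: bigcapT_measurable.
apply/eqP; rewrite -measure_le0; apply/lee_addgt0Pr => e e0; rewrite add0e.
have [n nlt] : exists n : nat, 4 / (mu ^+ 2 * e) + 2 * x / mu < n%:R.
  by exists (Num.truncn (4 / (mu ^+ 2 * e) + 2 * x / mu)).+1; exact: truncnS_gt.
have p1 : 0 < 4 / (mu ^+ 2 * e) by rewrite divr_gt0// mulr_gt0// exprn_gt0.
have p2 : 0 < 2 * x / mu by rewrite divr_gt0// mulr_gt0.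
have n0 : 0 < n%:R :> R by lra.
have n1 : 4 < n%:R * (mu ^+ 2 * e).
  by rewrite -ltr_pdivrMr ?mulr_gt0 ?exprn_gt0//; lra.
have n2 : 2 * x < mu * n%:R by rewrite [ltRHS]mulrC -ltr_pdivrMr//; lra.
pose a := mu * n%:R - x.
have [a0 a2] := hit_arith hx n2; rewrite -/a in a0 a2.
pose e' := x - mu * n%:R.
have [i2 E2] := bpath_second_moment hB x mu e' (ltW n0).
apply: (@le_trans _ _ (P (nonhit n))).
  by apply: le_measure; rewrite ?inE// => w; apply.
have ind : (P (nonhit n) = \int[P]_w (\1_(nonhit n) w)%:E)%E by rewrite integral_indic// setIT.
rewrite ind; apply: (@le_trans _ _ (\int[P]_w (a ^- 2 * (bp w n%:R - e') ^+ 2)%:E)%E).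
  apply: ge0_le_integral => //.
  - by apply/measurable_EFinP; exact: measurable_indic.
  - by apply: (measurable_int P); exact: integZ.
  move=> w _; rewrite lee_fin indicE; have [|] := boolP (w \in nonhit n); last first.
    by rewrite mulr_ge0 ?sqr_ge0// invr_ge0 sqr_ge0.
  rewrite inE /nonhit/= => w0; rewrite mulrC ler_pdivlMr ?exprn_gt0// mul1r.
  have -> : bp w n%:R - e' = bp w n%:R + a by rewrite /e' /a opprB.
  have ha := ltW a0.
  exact: sqr_le_addl.
rewrite -EFin_Ex; last exact: integZ.
rewrite ExZ// E2 lee_fin /e'.
rewrite (_ : (x - (x - mu * n%:R) - mu * n%:R) ^+ 2 = 0); last by rewrite (_ : _ - _ = 0) ?expr0n//; ring.
rewrite add0r mulrC ler_pdivrMr ?exprn_gt0//.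
have a4 : (mu * n%:R / 2) ^+ 2 <= a ^+ 2.
  by rewrite lerXn2r ?nnegrE ?(ltW a0)// divr_ge0// mulr_ge0// ltW.
apply: (@le_trans _ _ (e * (mu * n%:R / 2) ^+ 2)); last by rewrite ler_wpM2l// ltW.
rewrite (_ : e * _ = n%:R * (n%:R * (mu ^+ 2 * e)) / 4); last by field.
by rewrite ler_pdivlMr// ler_wpM2l ?(ltW n0)// ltW.
Qed.

Lemma regular_off_null : exists N, [/\ measurable N, P N = 0%E & forall w, ~ N w ->
  [/\ B 0 w = 0, continuous (fun t : R => bp w (Num.max t 0)) & exists2 t, 0 <= t & bp w t < 0]].
Proof.
have [N1 [m1 p1 h1]] := null_off_ae (bm_start hB).
have [N2 [m2 p2 h2]] := null_off_ae (bm_continuous_paths hB).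
have p3 := hit_null.
have m3 : measurable (\bigcap_n nonhit n) by exact: bigcapT_measurable.
exists (N1 `|` N2 `|` \bigcap_n nonhit n); split.
- by apply: measurableU => //; exact: measurableU.
- by rewrite !measureU0//; exact: measurableU.
move=> w nw; split.
- by apply: h1 => N1w; apply: nw; left; left.
- have cB : {within `[0, +oo[, continuous (fun t : R => B t w)}.
    by apply: h2 => N2w; apply: nw; left; right.
  have cm := continuous_max0 cB => t.
  have cid : Num.max u 0 @[u --> t] --> Num.max t 0.
    by apply: (@continuous_max0 R id); apply: continuous_subspaceT => u; exact: cvg_id.
  rewrite /bpath; apply: cvgD.
    by apply: cvgB; [exact: cvg_cst|apply: cvgM => //; exact: cvg_cst].
  by apply: cvgB; [exact: cm|exact: cvg_cst].
- have : ~ (forall n, 0 <= bp w n%:R).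
    by move=> h; apply: nw; right => n _; exact: h.
  move=> /existsNP[n /negP]; rewrite -ltNge => bn; exists n%:R => //.
Qed.

(** * Expectations off the exceptional null set *)

Section off_null.
Variable N : set T.
Hypotheses (mN : measurable N) (PN : P N = 0%E) (hN : forall w, ~ N w ->
  [/\ B 0 w = 0, continuous (fun t : R => bp w (Num.max t 0)) & exists2 t, 0 <= t & bp w t < 0]).

(** Multiplying by this measurable indicator makes the pathwise limits hold at every point, as
    [cvg_Ex_L2_bounded] demands. *)
Let on w : R := \1_(~` N) w.
Let f w (t : R) := bp w (Num.max t 0).
Let tau w := inf [set t | 0 < t /\ f w t <= 0].

Let mon : measurable_fun setT on.
Proof. by apply: measurable_indic; exact: measurableC. Qed.

Let onE w : (~ N w /\ on w = 1) \/ (N w /\ on w = 0).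
Proof.
have [Nw|Nw] := pselect (N w); [right|left]; split=> //; rewrite /on indicE.
  by rewrite memNset//= => h.
by rewrite mem_set.
Qed.

Lemma first_passage_time_tau w : ~ N w -> first_passage_time B x mu w = tau w.
Proof.
move=> /hN[B0 _ _]; rewrite /first_passage_time /tau; congr inf; apply/seteqP; split=> t [t0 h]; split=> //;
  by move: h; rewrite /f /bpath /drifted max_l ?(ltW t0)// B0 subr0.
Qed.

Let fcont w : ~ N w -> continuous (f w). Proof. by move=> /hN[]. Qed.
Let f0 w : f w 0 = x. Proof. by rewrite /f /bpath max_l// subrr mulr0 subr0 addr0. Qed.
Let fhit w : ~ N w -> exists2 t, 0 <= t & f w t < 0.
Proof. by move=> /hN[_ _ [t t0 h]]; exists t => //; rewrite /f max_l. Qed.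

Lemma tau_gt0 w : ~ N w -> 0 < tau w.
Proof. by move=> nw; exact: (first_passage_gt0 (fcont nw) (f0 w) hx (fhit nw)). Qed.

Lemma first_passage_area_primitive w : ~ N w -> first_passage_area B x mu w = primitive (f w) (tau w).
Proof.
move=> nw; have [B0 _ _] := hN nw.
rewrite /first_passage_area first_passage_time_tau// /primitive; apply: eq_Rintegral => t.
rewrite inE/= in_itv/= => /andP[t0 _].
by rewrite /drifted /f /bpath max_l// B0 subr0.
Qed.

Let Glev c m n w := grid_disc B x mu c (level x m) n w * on w.
Let Flev c m w := expR (- (rate mu c * hitting_below (fun t => f w t - level x m))) *
  primitive (fun t => f w t - level x m) (hitting_below (fun t => f w t - level x m)) * on w.
Definition damped_area c w := expR (- (rate mu c * tau w)) * primitive (f w) (tau w) * on w.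

Let on01 w : 0 <= on w <= 1.
Proof. by case: (onE w) => -[_ ->]; rewrite ?lexx ?ler01. Qed.

Let Ex_on (u : T -> R) : measurable_fun setT u -> Ex (fun w => u w * on w) = Ex u.
Proof.
move=> mu_; congr fine; apply: (eq_integral_off_null mN PN) => w nw.
by case: (onE w) => -[// _ ->]; rewrite mulr1.
Qed.

Let integ_on2 (u : T -> R) : measurable_fun setT u -> integ (fun w => u w ^+ 2) ->
  integ (fun w => (u w * on w) ^+ 2).
Proof.
move=> mu_ iu; apply: (integ_le _ iu); first by apply: measurable_funX; exact: measurable_funM.
move=> w; rewrite ger0_norm ?sqr_ge0//.
by case: (onE w) => -[_ ->]; rewrite ?mulr1 ?mulr0 ?expr0n ?sqr_ge0.
Qed.

(** The mesh limit at a fixed level. [cvg_Ex_L2_bounded] gives convergence of the expectations to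
    that of [Flev], [cvg_Ex_grid_disc] gives their numerical limit, and uniqueness of limits
    identifies the two. *)
Let Flev_facts c m : 0 < c ->
  [/\ measurable_fun setT (Flev c m), integ (fun w => Flev c m w ^+ 2),
      Ex (fun w => Flev c m w ^+ 2) <= dom2_bound mu (grid_q x mu) c,
      (forall w, 0 <= Flev c m w) & Ex (Flev c m) = limit_value mu c (x - level x m)].
Proof.
move=> c0.
have l0 : 0 <= level x m by apply: ltW; exact: level_gt0.
have lx : level x m < x by exact: level_ltx.
have hs0 n := grid_step_gt0 R n.
have mG n : measurable_fun setT (grid_disc B x mu c (level x m) n).
  exact: (grid_disc_measurable hB hx hmu (hs0 n) l0 lx c _).
have i2 n := (grid_disc_L2 hB hx hmu (hs0 n) (grid_step_le1 R n) l0 lx c0 (n.+1 ^ 6)).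
have G0 n w : 0 <= Glev c m n w.
  apply: mulr_ge0; last by case/andP: (on01 w).
  exact: (grid_disc_ge0 B mu (hs0 n) lx).
have iG n : integ (fun w => Glev c m n w ^+ 2) by apply: integ_on2 => //; exact: (i2 n).1.
have cG w : Glev c m n w @[n --> \oo] --> Flev c m w.
  case: (onE w) => -[nw onw]; last first.
    rewrite /Flev onw mulr0 (_ : (fun n => _) = cst 0); first exact: cvg_cst.
    by apply/funext => n; rewrite /Glev onw mulr0.
  rewrite /Flev onw mulr1.
  pose g t := f w t - level x m.
  have cg : continuous g by move=> t; apply: cvgB; [exact: fcont|exact: cvg_cst].
  have g0 : 0 < g 0 by rewrite /g f0 subr_gt0.
  have gh : exists2 t, 0 <= t & g t < 0.
    by have [t t0 ft] := fhit nw; exists t => //; rewrite /g; lra.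
  have := @cvg_disc R g (rate mu c) cg g0 gh.
  rewrite (_ : (fun n => disc _ _ _ _) = (fun n => Glev c m n w))//.
  apply/funext => n; rewrite /Glev onw mulr1 /grid_disc; congr disc.
  by apply/funext => k; rewrite /g /f max_l// mulr_ge0// ltW.
have sqle n w : Glev c m n w ^+ 2 <= grid_disc B x mu c (level x m) n w ^+ 2.
  by rewrite /Glev; case: (onE w) => -[_ ->]; rewrite ?mulr1 ?mulr0 ?expr0n ?sqr_ge0.
have mGl n : measurable_fun setT (Glev c m n) by exact: measurable_funM.
have EG n : Ex (fun w => Glev c m n w ^+ 2) <= dom2_bound mu (grid_q x mu) c.
  by apply: le_trans (i2 n).2; apply: Ex_le (sqle n); [exact: iG|exact: (i2 n).1].
have [mF iF EF cF] := cvg_Ex_L2_bounded mGl G0 iG EG cG.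
split=> //.
  move=> w; have /(@cvg_lim _ _) <-// := cG w; apply: limr_ge; first by apply/cvg_ex; exists (Flev c m w).
  by near=> n; exact: G0.
have cv := cvg_Ex_grid_disc hB hx hmu c0 l0 lx.
have {}cF : Ex (grid_disc B x mu c (level x m) n) @[n --> \oo] --> Ex (Flev c m).
  by rewrite (_ : (fun n => _) = (fun n => Ex (Glev c m n)))//; apply/funext => n; rewrite -[LHS]Ex_on.
by rewrite -(cvg_lim _ cF)//; exact/cvg_lim.
Unshelve. all: by end_near. Qed.

Let continuous_limit_value c : continuous (limit_value mu c).
Proof.
move=> y; rewrite /limit_value; apply: cvgM.
  apply: continuous_cvg; first exact: continuous_expR.
  by apply: cvgN; apply: cvgM; [exact: cvg_cst|exact: cvg_id].
apply: cvgD; apply: cvgM; try exact: cvg_cst; last exact: cvg_id.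
exact: exprn_continuous.
Qed.

(** The level limit. The second-moment bound inherited from the mesh limit does not depend on [m],
    so the same convergence lemma applies again. *)
Lemma damped_area_facts c : 0 < c ->
  [/\ measurable_fun setT (damped_area c), integ (damped_area c),
      (forall w, 0 <= damped_area c w) & Ex (damped_area c) = limit_value mu c x].
Proof.
move=> c0.
have mF m : measurable_fun setT (Flev c m) by have [] := Flev_facts m c0.
have iF m : integ (fun w => Flev c m w ^+ 2) by have [] := Flev_facts m c0.
have EF m : Ex (fun w => Flev c m w ^+ 2) <= dom2_bound mu (grid_q x mu) c by have [] := Flev_facts m c0.
have F0 m w : 0 <= Flev c m w by have [] := Flev_facts m c0.
have VF m : Ex (Flev c m) = limit_value mu c (x - level x m) by have [] := Flev_facts m c0.
have cF w : Flev c m w @[m --> \oo] --> damped_area c w.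
  case: (onE w) => -[nw onw]; last first.
    rewrite /damped_area onw mulr0 (_ : (fun n => _) = cst 0); first exact: cvg_cst.
    by apply/funext => n; rewrite /Flev onw mulr0.
  apply: cvgM; last exact: cvg_cst.
  have hh := @cvg_levels R (f w) (rate mu c) x (fcont nw) (f0 w) hx (fhit nw).
  exact: hh.
have [mD iD _ cD] := cvg_Ex_L2_bounded mF F0 iF EF cF.
split=> //.
- exact: integ_L2.
- move=> w; have /(@cvg_lim _ _) <-// := cF w; apply: limr_ge; first by apply/cvg_ex; exists (damped_area c w).
  by near=> n; exact: F0.
have cV : Ex (Flev c m) @[m --> \oo] --> limit_value mu c x.
  rewrite (_ : (fun m => _) = (fun m => limit_value mu c (x - level x m))); last by apply/funext.
  apply: continuous_cvg; first exact: continuous_limit_value.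
  rewrite -[X in _ --> X]subr0; apply: cvgB; first exact: cvg_cst.
  exact: cvg_level.
by rewrite -(cvg_lim _ cD)//; exact/cvg_lim.
Unshelve. all: by end_near. Qed.

Definition total_area w := primitive (f w) (tau w) * on w.

Let damped_total c w : damped_area c w = expR (- (rate mu c * tau w)) * total_area w.
Proof. by rewrite /damped_area /total_area mulrA. Qed.

(** Letting the rate tend to 0 exhibits the area as a pointwise limit of measurable functions; its
    measurability and sign are read off from this. *)
Let cvg_damped w : damped_area n.+1%:R^-1 w @[n --> \oo] --> total_area w.
Proof.
rewrite (_ : (fun n => _) = (fun n : nat => expR (- (rate mu (n.+1%:R^-1) * tau w)) * total_area w)); last first.
  by apply/funext => n; rewrite damped_total.
rewrite -[X in _ --> X]mul1r; apply: cvgM; last exact: cvg_cst.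
have ci : (n.+1%:R^-1 : R) @[n --> \oo] --> (0 : R) by exact: cvg_harmonic.
have cr : rate mu n.+1%:R^-1 @[n --> \oo] --> rate mu 0.
  rewrite /rate; apply: cvgD; last by apply: cvgM => //; exact: cvg_cst.
  apply: cvgM; last exact: cvg_cst.
  exact: (cvgM ci ci).
suff : expR (- (rate mu n.+1%:R^-1 * tau w)) @[n --> \oo] --> expR (- (rate mu 0 * tau w)).
  by rewrite [rate mu 0]/rate expr0n/= mul0r mulr0 addr0 mul0r oppr0 expR0.
apply: continuous_cvg; first exact: continuous_expR.
by apply: cvgN; apply: cvgM => //; exact: cvg_cst.
Qed.

Let measurable_total : measurable_fun setT total_area.
Proof.
apply: (measurable_fun_cvg (h := fun n => damped_area n.+1%:R^-1)) => [n|w _]; last exact: cvg_damped.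
by have [] := @damped_area_facts n.+1%:R^-1; rewrite ?invr_gt0.
Qed.

Let total_ge0 w : 0 <= total_area w.
Proof.
have /(@cvg_lim _ _) <-// := @cvg_damped w; apply: limr_ge.
  by apply/cvg_ex; exists (total_area w); exact: cvg_damped.
by near=> n; have [] := @damped_area_facts n.+1%:R^-1; rewrite ?invr_gt0.
Unshelve. all: by end_near. Qed.

(* A version of the passage time whose measurability is immediate; it agrees with
   [tau] wherever [total_area] does not vanish. *)
Let time w := (ln (total_area w) - ln (damped_area 1 w)) / rate mu 1.

Let measurable_time : measurable_fun setT time.
Proof.
have [md _ _ _] := damped_area_facts ltr01.
apply: measurable_funM => //; apply: measurable_funB.
  exact: (measurableT_comp (@measurable_ln R) measurable_total).
exact: (measurableT_comp (@measurable_ln R) md).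
Qed.

Let damped_time c w : damped_area c w = expR (- (rate mu c * time w)) * total_area w.
Proof.
rewrite damped_total; have [->|A0] := eqVneq (total_area w) 0; first by rewrite !mulr0.
have Apos : 0 < total_area w by rewrite lt_neqAle eq_sym A0 total_ge0.
suff -> : time w = tau w by [].
have r1 : rate mu 1 != 0 by rewrite gt_eqF//; exact: rate_gt0.
rewrite /time damped_total lnM ?posrE ?expR_gt0// expRK.
by rewrite opprD opprK addrCA subrr addr0 mulrC mulKf.
Qed.

(** Since [rate] has derivative [c + mu], an antiderivative is [- exp (- rate mu c * t) / t]; it
    vanishes at infinity because [rate mu c >= mu * c]. *)
Lemma integral_rate (t : R) : 0 < t ->
  (\int[lebesgue_measure]_(c in `[0%R, +oo[) ((c + mu) * expR (- (rate mu c * t)))%:E = (t^-1)%:E)%E.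
Proof.
move=> t0.
have dF (c : R) : is_derive c 1 (fun c => - (t^-1 * expR (- (rate mu c * t)))) ((c + mu) * expR (- (rate mu c * t))).
  rewrite /rate; apply: is_derive_eq; rewrite !scaler0 /GRing.scale/=; field; rewrite gt_eqF//.
have cdF (F : R -> R) (c dv : R) : is_derive c 1 F dv -> F u @[u --> c] --> F c.
  by move=> h; apply: differentiable_continuous; apply/derivable1_diffP; exact: ex_derive.
have := @ge0_continuous_FTC2y R (fun c => (c + mu) * expR (- (rate mu c * t))) (fun c => - (t^-1 * expR (- (rate mu c * t)))) 0 0.
rewrite (_ : rate mu 0 = 0); last by rewrite /rate expr0n/= mul0r mulr0 addr0.
rewrite mul0r oppr0 expR0 mulr1 EFinN oppeK add0e; apply.
- by move=> c c0; rewrite mulr_ge0 ?expR_ge0// addr_ge0// ltW.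
- apply: continuous_subspaceT => c; apply: cvgM.
    by apply: cvgD; [exact: cvg_id|exact: cvg_cst].
  apply: continuous_cvg; first exact: continuous_expR.
  apply: cvgN; apply: cvgM; last exact: cvg_cst.
  apply: cvgD; apply: cvgM; try exact: cvg_cst; last exact: cvg_id.
  exact: exprn_continuous.
- rewrite -oppr0; apply: cvgN; rewrite -(mulr0 t^-1); apply: cvgM; first exact: cvg_cst.
  apply/cvgrPdist_lt => e e0; near=> c.
  have c0 : 0 < c by near: c; exact: nbhs_pinfty_gt.
  have mt : 0 < mu * t by rewrite mulr_gt0.
  have ce : (e * (mu * t))^-1 < c by near: c; apply: nbhs_pinfty_gt; rewrite num_real.
  rewrite sub0r normrN ger0_norm ?expR_ge0// expRN invf_plt ?posrE ?expR_gt0//.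
  apply: (@lt_le_trans _ _ (mu * c * t)).
    by move: ce; rewrite invfM -ltr_pdivlMr ?invr_gt0// invrK => h; rewrite -mulrA (mulrC c) mulrA mulrC.
  apply: (@le_trans _ _ (rate mu c * t)).
    by rewrite ler_wpM2r ?(ltW t0)// /rate lerDr divr_ge0// sqr_ge0.
  by rewrite (le_trans _ (expR_ge1Dx _))// lerDr.
- by move=> c _; exact: (@ex_derive _ _ _ _ _ _ _ (dF c)).
- apply: cvg_at_right_filter; have := cdF _ _ _ (dF 0).
  by rewrite (_ : rate mu 0 = 0) ?mul0r ?oppr0 ?expR0 ?mulr1// /rate expr0n/= mul0r mulr0 addr0.
- by move=> c _; rewrite derive1E (derive_val (is_derive := dF c)).
Unshelve. all: by end_near. Qed.

(** Written with [time] instead of [tau], which makes it jointly measurable in [c] and [w]. *)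
Let integrand c w := (c + mu) * (expR (- (rate mu c * time w)) * total_area w).

(** Open at 0 because [damped_area_facts] is available for [c > 0]. *)
Let D : set R := `]0, +oo[.

Let mD : measurable D. Proof. exact: measurable_itv. Qed.

Let D_gt0 c : c \in D -> 0 < c. Proof. by rewrite inE /D/= in_itv/= andbT. Qed.

Let measurable_integrand :
  measurable_fun setT (fun z : T * R => (integrand z.2 z.1 * \1_D z.2)%:E).
Proof.
apply/measurable_EFinP; apply: measurable_funM; last first.
  exact: (measurableT_comp (measurable_indic mD) measurable_snd).
apply: measurable_funM; first exact: measurable_funD.
apply: measurable_funM; last exact: (measurableT_comp measurable_total).
apply: (measurableT_comp (@measurable_expR R)); apply: measurableT_comp => //.
apply: measurable_funM; last exact: (measurableT_comp measurable_time).
rewrite /rate; apply: measurable_funD; apply: measurable_funM => //.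
exact: measurable_funX.
Qed.

Lemma mean_ratio_laplace :
  (\int[P]_w (first_passage_area B x mu w / first_passage_time B x mu w)%:E =
   \int[lebesgue_measure]_(c in D) ((c + mu) * limit_value mu c x)%:E)%E.
Proof.
pose F (z : T * R) := (integrand z.2 z.1 * \1_D z.2)%:E.
have F0 z : (0 <= F z)%E.
  rewrite lee_fin indicE; have [|_] := boolP (z.2 \in D); last by rewrite mulr0.
  move=> /D_gt0 z0; rewrite mulr1; apply: mulr_ge0; first by apply: addr_ge0; exact: ltW.
  by apply: mulr_ge0; [exact: expR_ge0|exact: total_ge0].
(* The ratio on the left has not been shown measurable, so it is exchanged for a measurable
   expression by equality off [N] alone. *)
rewrite (eq_integral_off_null (g := fun w => \int[lebesgue_measure]_c F (w, c))%E mN PN); last first.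
  move=> w nw; have t0 := tau_gt0 nw.
  rewrite first_passage_area_primitive// first_passage_time_tau//.
  have tot : total_area w = primitive (f w) (tau w).
    by rewrite /total_area; case: (onE w) => -[// _ ->]; rewrite mulr1.
  have mr : measurable_fun setT (fun c : R => ((c + mu) * expR (- (rate mu c * tau w)))%:E).
    apply/measurable_EFinP; apply: measurable_funM; first exact: measurable_funD.
    apply: (measurableT_comp (@measurable_expR R)); apply: measurableT_comp => //.
    apply: measurable_funM => //.
    by rewrite /rate; apply: measurable_funD; apply: measurable_funM => //.
  rewrite -tot EFinM -integral_rate// -integral_itv_obnd_cbnd; last exact: measurable_funTS.
  rewrite -ge0_integralZl; [|exact: measurable_itv|exact: measurable_funTS| |exact: total_ge0]; last first.
    by move=> c /=; rewrite in_itv/= andbT => c0; rewrite lee_fin mulr_ge0 ?expR_ge0// addr_ge0// ltW.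
  rewrite integral_mkcond; apply: eq_integral => c _.
  rewrite epatch_indic /F /integrand/= -damped_time damped_total -!EFinM; congr EFin.
  ring.
transitivity (\int[lebesgue_measure]_c \int[P]_w F (w, c))%E.
  exact: (@fubini_tonelli _ _ _ _ _ P (@lebesgue_measure R) F measurable_integrand F0).
rewrite [RHS]integral_mkcond; apply: eq_integral => c _; rewrite epatch_indic/= indicE.
have [cD|cD] := boolP (c \in D); last first.
  by rewrite mule0; apply: integral0_eq => w _; rewrite /F/= indicE (negbTE cD) mulr0.
have [_ iA _ <-] := damped_area_facts (D_gt0 cD).
rewrite mule1 -ExZ// EFin_Ex; last exact: integZ.
by apply: eq_integral => w _; rewrite /F/= indicE cD mulr1 /integrand -damped_time.
Qed.

End off_null.
End brownian_paths.

(** * Evaluation of the final integral *)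

Section laplace_integral.
Context (R : realType).
Variables (x mu : R).
Hypotheses (hx : 0 < x) (hmu : 0 < mu).
Local Notation leb := (@lebesgue_measure R).

Lemma integral_exp : (\int[leb]_(c in `[0%R, +oo[) (x * expR (- (c * x)))%:E = 1)%E.
Proof.
have dF (c : R) : is_derive c 1 (fun c => - expR (- (c * x))) (x * expR (- (c * x))).
  by apply: is_derive_eq; rewrite !scaler0 /GRing.scale/=; ring.
have cdF (F : R -> R) (c dv : R) : is_derive c 1 F dv -> F u @[u --> c] --> F c.
  by move=> h; apply: differentiable_continuous; apply/derivable1_diffP; exact: ex_derive.
have := @ge0_continuous_FTC2y R (fun c => x * expR (- (c * x))) (fun c => - expR (- (c * x))) 0 0.
rewrite mul0r oppr0 expR0 EFinN oppeK add0e; apply.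
- by move=> c c0; rewrite mulr_ge0 ?expR_ge0// ltW.
- apply: continuous_subspaceT => c; apply: cvgM; first exact: cvg_cst.
  apply: continuous_cvg; first exact: continuous_expR.
  by apply: cvgN; apply: cvgM; [exact: cvg_id|exact: cvg_cst].
- rewrite -oppr0; apply: cvgN; apply/cvgrPdist_lt => e e0; near=> c.
  have ce : (e * x)^-1 < c by near: c; apply: nbhs_pinfty_gt; rewrite num_real.
  rewrite sub0r normrN ger0_norm ?expR_ge0// expRN invf_plt ?posrE ?expR_gt0//.
  apply: (@lt_le_trans _ _ (c * x)).
    by move: ce; rewrite invfM -ltr_pdivlMr ?invr_gt0// invrK.
  by rewrite (le_trans _ (expR_ge1Dx _))// lerDr.
- by move=> c _; exact: (@ex_derive _ _ _ _ _ _ _ (dF c)).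
- apply: cvg_at_right_filter; have := cdF _ _ _ (dF 0).
  by rewrite mul0r oppr0 expR0.
- by move=> c _; rewrite derive1E (derive_val (is_derive := dF c)).
Unshelve. all: by end_near. Qed.

(** The integrand equals [x / 2] times [x exp (- c x) + exp (- c x) / (c + mu)]. The first summand
    is an exponential density and produces the 1 of the formula. *)
Lemma integral_limit_value :
  (\int[leb]_(c in `]0%R, +oo[) ((c + mu) * limit_value mu c x)%:E =
   (x / 2)%:E * (1 + \int[leb]_(s in `[0%R, +oo[) (expR (- (s * x)) / (s + mu))%:E))%E.
Proof.
have mexp : measurable_fun setT (fun c : R => expR (- (c * x))).
  apply: (measurableT_comp (@measurable_expR R)); apply: measurableT_comp => //.
  exact: measurable_funM.
pose I : set R := `[0%R, +oo[%classic.
have mI : measurable I by exact: measurable_itv.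
have minv : measurable_fun I (fun c : R => (c + mu)^-1).
  apply: subspace_continuous_measurable_fun => //; apply/continuous_within_itvcyP; split.
    move=> c; rewrite in_itv/= andbT => c0; apply: cvgV; first by rewrite gt_eqF// addr_gt0.
    by apply: cvgD; [exact: cvg_id|exact: cvg_cst].
  apply: cvg_at_right_filter; apply: cvgV; first by rewrite gt_eqF// add0r.
  by apply: cvgD; [exact: cvg_id|exact: cvg_cst].
have m1 : measurable_fun I (fun c : R => (x * expR (- (c * x)))%:E).
  by apply/measurable_EFinP; apply: measurable_funTS; exact: measurable_funM.
have m2 : measurable_fun I (fun c : R => (expR (- (c * x)) / (c + mu))%:E).
  by apply/measurable_EFinP; apply: measurable_funM => //; exact: measurable_funTS.
have p1 (c : R) : I c -> (0 <= (x * expR (- (c * x)))%:E)%E.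
  by move=> _; rewrite lee_fin mulr_ge0 ?expR_ge0// ltW.
have p2 (c : R) : I c -> (0 <= (expR (- (c * x)) / (c + mu))%:E)%E.
  rewrite /I/= in_itv/= andbT => c0; rewrite lee_fin mulr_ge0 ?expR_ge0// invr_ge0 addr_ge0//.
  by rewrite ltW.
have x2 : 0 <= x / 2 by rewrite divr_ge0// ltW.
rewrite -integral_exp -ge0_integralD// -ge0_integralZl//; last 2 first.
- exact: emeasurable_funD.
- by move=> c c0; rewrite adde_ge0 ?p1 ?p2.
have eqc (c : R) : 0 < c -> ((c + mu) * limit_value mu c x)%:E =
    ((x / 2)%:E * ((x * expR (- (c * x)))%:E + (expR (- (c * x)) / (c + mu))%:E))%E.
  move=> c0; rewrite -EFinD -EFinM; congr EFin; rewrite /limit_value.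
  by field; rewrite gt_eqF// addr_gt0.
transitivity (\int[leb]_(c in `]0%R, +oo[)
    ((x / 2)%:E * ((x * expR (- (c * x)))%:E + (expR (- (c * x)) / (c + mu))%:E)))%E.
  by apply: eq_integral => c; rewrite inE/= in_itv/= andbT => /eqc.
apply: integral_itv_obnd_cbnd.
have sI : `]0%R, +oo[%classic `<=` I by apply: subset_itvr; rewrite bnd_simp.
apply: (measurable_funS mI sI); apply: emeasurable_funM => //; exact: emeasurable_funD.
Qed.

End laplace_integral.

Theorem mainTheorem7 (R : realType) (d : measure_display) (T : measurableType d)
    (P : probability T R) (B : R -> {RV P >-> R})
    (hB : standard_brownian_motion B) (x mu : R) (hx : 0 < x) (hmu : 0 < mu) :
  ('E_P[(fun w => first_passage_area B x mu w / first_passage_time B x mu w)%R] =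
   (x / 2)%:E *
     (1 + \int[lebesgue_measure]_(s in `[0%R, +oo[)
            (expR (- (s * x)) / (s + mu))%:E))%E.
Proof.
have [N [mN PN hN]] := regular_off_null hB hx hmu.
by rewrite unlock (mean_ratio_laplace hB hx hmu mN PN hN) integral_limit_value.
Qed.
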